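(* Let $K$ be an imaginary quadratic field with group of roots of unity $\mu_K$, and let $B\ge1$. Fix integral ideals $\mathfrak a_1,\ldots,\mathfrak a_h$ forming a complete set of representatives of the ideal class group of $\mathcal O_K$. For each $\ell$, let $g_{\ell,1},\ldots,g_{\ell,s_\ell}\in\mathcal O_K$ be generators of all the distinct nonzero principal ideals contained in $\mathfrak a_\ell$ whose norms are at most $B\cdot N(\mathfrak a_\ell)$, one generator for each such ideal. Call a $B$-packet any tuple $P=(\ell,(i,j))$ with $1\le\ell\le h$, $1\le i<j\le s_\ell$ and $(g_{\ell,i},g_{\ell,j})=\mathfrak a_\ell$ (the ideal generated by $g_{\ell,i},g_{\ell,j}$), and set $c(P)=g_{\ell,i}/g_{\ell,j}$ and $F(P)=\{\zeta c(P):\zeta\in\mu_K\}\cup\{\zeta/c(P):\zeta\in\mu_K\}$. Then \[\{\gamma\in K^{*}:H_K(\gamma)\le B\}=\mu_K\cup\bigcup_{B\text{-packets }P}F(P).\]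
   Context: $N(I)=\#(\mathcal O_K/I)$. $H_K(\gamma)=\prod_{v\in M_K}\max\{|\gamma|_v^{n_v},1\}$ is the relative height on $K$: the product over all places of $K$, where the unique archimedean place has $|x|_v=|x|$ (complex absolute value) and $n_v=2$, and the place attached to a maximal ideal $\mathfrak p$ has $|x|_{\mathfrak p}=N(\mathfrak p)^{-v_{\mathfrak p}(x)/(e(\mathfrak p)f(\mathfrak p))}$ and $n_v=e(\mathfrak p)f(\mathfrak p)$. *)

(* Defs.v *)
From HB Require Import structures.
From mathcomp Require Import all_boot all_order all_algebra all_field.
From mathcomp Require Import complex finmap.
From mathcomp Require Import boolp classical_sets functions cardinality fsbigop.
From mathcomp Require Import reals exp.

Set Implicit Arguments.
Unset Strict Implicit.
Unset Printing Implicit Defensive.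

Import Order.TTheory GRing.Theory Num.Theory.

Local Open Scope classical_set_scope.
Local Open Scope ring_scope.

Definition imaginary_quadratic (R : realType) (K : fieldExtType rat) : Prop :=
  \dim {:K} = 2%N /\ ({rmorphism K -> R} -> False).

Section NumberField.
Variable K : fieldExtType rat.
Implicit Types (I J P : set K) (x y : K).

Definition OK : set K := [set x | integralOver (intr : int -> K) x].

Definition roots_of_unity : set K :=
  [set z | exists2 n : nat, (0 < n)%N & n.-unity_root z].

(* Integral ideals are subsets of K; the zero ideal is included. *)
Definition integral_ideal I : Prop :=
  [/\ I `<=` OK, I 0, (forall x y, I x -> I y -> I (x + y)) &
      (forall a x, OK a -> I x -> I (a * x))].

Definition ideal_gen (S : set K) : set K := smallest integral_ideal S.

Definition principal_ideal I : Prop := exists2 x, OK x & I = ideal_gen [set x].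

Definition maximal_ideal P : Prop :=
  [/\ integral_ideal P, P <> OK &
      forall J, integral_ideal J -> P `<=` J -> J = P \/ J = OK].

Definition ideal_mul I J : set K :=
  ideal_gen [set z | exists x y, [/\ I x, J y & z = x * y]].

Definition ideal_exp P (n : nat) : set K := iter n (ideal_mul P) OK.

Definition residues I : set (set K) :=
  [set [set y | OK y /\ I (y - x)] | x in OK].

(* fset_set sends infinite sets to the empty one, so the zero ideal has norm 0;
   O_K / I is finite for every other integral ideal I. *)
Definition ideal_norm I : nat := #|` fset_set (residues I) |%fset.

Definition dilate (alpha : K) I : set K := [set alpha * x | x in I].

Definition fractional_ideal I : Prop :=
  [/\ I 0, (exists2 x, I x & x != 0),
      (forall x y, I x -> I y -> I (x + y)),
      (forall a x, OK a -> I x -> I (a * x)) &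
      (exists d, [/\ OK d, d != 0 & dilate d I `<=` OK])].

Definition ideal_class I : set (set K) :=
  [set J | fractional_ideal J /\ exists2 alpha, alpha != 0 & J = dilate alpha I].

Definition class_group : set (set (set K)) :=
  [set ideal_class I | I in fractional_ideal].

(* In the definitions by [get] and [xget] below the described integer exists and is unique
   when P is a maximal ideal (and x != 0). *)
Definition residue_char P : nat := get [set p : nat | prime p /\ P p%:R].

(* There is a family of d elements of O_K whose classes form a basis of O_K / P
   over F_p, p the characteristic of O_K / P; coefficients are lifted to int. *)
Definition residue_basis P (d : nat) (b : 'I_d -> K) : Prop :=
  [/\ (forall i, OK (b i)),
      (forall y, OK y ->
         exists c : 'I_d -> int, P (y - \sum_(i < d) (c i)%:~R * b i)) &
      (forall c : 'I_d -> int, P (\sum_(i < d) (c i)%:~R * b i) ->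
         forall i, ((residue_char P)%:Z %| c i)%Z)].

Definition inertia_degree P : nat :=
  get [set d : nat | exists b : 'I_d -> K, residue_basis P b].

Definition ord_int P (a : K) : nat :=
  get [set n : nat | ideal_exp P n a /\ ~ ideal_exp P n.+1 a].

Definition ramification_index P : nat := ord_int P (residue_char P)%:R.

Definition valuation P x : int :=
  xget 0 [set n : int | exists a b, [/\ OK a, OK b, a != 0, b != 0 &
         x = a / b /\ n = (ord_int P a)%:Z - (ord_int P b)%:Z]].

(* A place is either the archimedean one, [None], or [Some P] for a maximal
   ideal P. *)
Definition places : set (option (set K)) :=
  [set v | if v is Some P then maximal_ideal P else True].

Definition local_degree (v : option (set K)) : nat :=
  if v is Some P then (ramification_index P * inertia_degree P)%N else 2%N.

(* sigma is the embedding through which K is viewed inside the complex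
   numbers. *)
Definition place_abs (R : realType) (sigma : {rmorphism K -> R[i]})
    (v : option (set K)) (x : K) : R :=
  if v is Some P then
    if x == 0 then 0
    else (ideal_norm P)%:R `^
      (- (valuation P x)%:~R / (ramification_index P * inertia_degree P)%:R)
  else Normc.normc (sigma x).

Definition height (R : realType) (sigma : {rmorphism K -> R[i]}) (x : K) : R :=
  \big[*%R/1]_(v \in places) Num.max (place_abs sigma v x ^+ local_degree v) 1.

Definition class_representatives (h : nat) (a : 'I_h -> set K) : Prop :=
  (forall l, integral_ideal (a l)) /\
  set_bij [set: 'I_h] class_group (fun l => ideal_class (a l)).

Definition bounded_principal_ideals (R : realType) (B : R) (A : set K) :
    set (set K) :=
  [set I | [/\ principal_ideal I, I <> [set 0], I `<=` A &
             (ideal_norm I)%:R <= B * (ideal_norm A)%:R]].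

(* One generator for each ideal: indexing by i is injective on ideals. *)
Definition lists_generators (R : realType) (B : R) (A : set K)
    (s : nat) (g : 'I_s -> K) : Prop :=
  (forall i, OK (g i)) /\
  set_bij [set: 'I_s] (bounded_principal_ideals B A)
    (fun i => ideal_gen [set g i]).

Section Packets.
Variables (h : nat) (a : 'I_h -> set K) (s : 'I_h -> nat).
Variable g : forall l : 'I_h, 'I_(s l) -> K.

Definition packet_index : Type := {l : 'I_h & ('I_(s l) * 'I_(s l))%type}.

(* The bound B enters only through the list of generators g. *)
Definition packets : set packet_index :=
  [set p : packet_index | let: existT l ij := p in
     (ij.1 < ij.2)%N /\ ideal_gen [set g ij.1; g ij.2] = a l].

Definition packet_c (p : packet_index) : K :=
  let: existT l ij := p in g ij.1 / g ij.2.

Definition packet_F (p : packet_index) : set K :=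
  [set zeta * packet_c p | zeta in roots_of_unity] `|`
  [set zeta / packet_c p | zeta in roots_of_unity].

End Packets.
End NumberField.

Arguments OK K _ : clear implicits.
Arguments roots_of_unity K _ : clear implicits.
Arguments class_group K _ : clear implicits.
Arguments places K _ : clear implicits.

(* Main.v *)
Require Import Defs.
From HB Require Import structures.
From mathcomp Require Import all_boot all_order all_algebra all_field.
From mathcomp Require Import complex finmap.
From mathcomp Require Import boolp classical_sets functions cardinality fsbigop.
From mathcomp Require Import reals exp.
From mathcomp Require Import ring lra zify.

Set Implicit Arguments.
Unset Strict Implicit.
Unset Printing Implicit Defensive.

Import Order.TTheory GRing.Theory Num.Theory.

Local Open Scope classical_set_scope.
Local Open Scope ring_scope.

(* For nonzero integers x, y of K the height of x / y is
   max(N(x), N(y)) / N((x, y)): writing (x) = I X and (y) = I Y with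
   I = (x, y), the ideals X and Y have no common prime factor, so the finite
   places contribute exactly N(Y) = N(y) / N(I). Every gamma can be written
   x / y with (x, y) equal to one of the given class representatives, and
   units have norm 1 and hence are roots of unity; so H(gamma) <= B says that
   (x) and (y) both occur in the list of bounded principal ideals, and gamma
   is then a root of unity times the quotient of the two listed generators.

   The ideal theory rests on the Gauss lemma I * conj I = (n), which makes
   every nonzero ideal invertible without any choice of generators. *)

(** * Conjugation and the ring of integers *)

(** No square root generating K is chosen: conjugation is pulled back along [sigma]. Degree 2 makes
    the image of [sigma] stable under complex conjugation, and the absence of a real embedding makes
    the pulled back map nontrivial. Its fixed field is then Q, so traces and norms of integers are
    rational integers; the facts about ideals are extracted from this. Since [ideal_norm] counts
    cosets and no quotient ring is formed, multiplicativity is obtained by counting representatives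
    in towers of additive subgroups, one maximal ideal at a time. The product e f in [local_degree]
    cancels the denominator of the exponent in [place_abs] once it is nonzero. As e and f are picked
    by [get], this requires showing that the integers they describe exist. *)

Lemma int_subgroup_principal (S : set int) :
  (forall m n, S m -> S n -> S (m - n)) -> (exists2 m, S m & m != 0) ->
  exists n : nat, [/\ (0 < n)%N, S n%:Z & forall m, S m -> (n%:Z %| m)%Z].
Proof.
move=> SB [m0 Sm0 m0_neq0].
have S0 : S 0 by rewrite -(subrr m0); apply: SB.
have SN m : S m -> S (- m) by move=> Sm; rewrite -sub0r; apply: SB.
have SD m n : S m -> S n -> S (m + n).
  by move=> Sm Sn; rewrite -[n]opprK; apply/SB/SN.
have SMn m (k : nat) : S m -> S (m * k%:Z).
  move=> Sm; elim: k => [|k IHk]; first by rewrite mulr0.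
  by rewrite -addn1 PoszD mulrDr mulr1; apply: SD.
have SM m k : S m -> S (m * k).
  by case: (intP k) => [|k'|k'] Sm; rewrite ?mulr0 ?mulrN //; [|apply: SN]; apply: SMn.
have exP : exists n : nat, `[< (0 < n)%N /\ S n%:Z >].
  exists `|m0|%N; apply/asboolP; split; first by rewrite absz_gt0.
  by rewrite abszE; case: (ger0P m0) => _ //; apply: SN.
case: (ex_minnP exP) => n /asboolP[n_gt0 Sn] min_n.
exists n; split=> // m Sm; apply/dvdz_mod0P.
have Sr : S (m %% n)%Z.
  have -> : (m %% n)%Z = m - n%:Z * (m %/ n)%Z by rewrite {2}(divz_eq m n); ring.
  by apply: SB => //; apply: SM.
have r_ge0 : 0 <= (m %% n)%Z by apply: modz_ge0; lia.
have r_lt : (m %% n)%Z < n by apply: ltz_pmod.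
case def_r: (m %% n)%Z r_ge0 r_lt Sr => [r|//] _ r_lt Sr.
have [-> //|r_gt0] := posnP r.
by have := min_n r (asboolT (conj r_gt0 Sr)); lia.
Qed.

Section ImaginaryQuadratic.
Variables (R : realType) (K : fieldExtType rat) (sigma : {rmorphism K -> R[i]}).
Hypothesis imagK : imaginary_quadratic R K.
Implicit Types (x y z : K) (q : rat) (m n : int).

(** Degree 2 enters here: an irrational z and 1 form a basis of K over Q. *)
Lemma rational_or_spanning z :
  (exists q, z = q%:A) \/ forall w, exists q r, w = q%:A + r%:A * z.
Proof.
have [zQ|zNQ] := boolP (z \in <[1]>%VS).
  by left; have [q ->] := vlineP _ _ zQ; exists q.
right=> w.
have freeX : free [:: z; 1] by rewrite free_cons span_seq1 zNQ seq1_free oner_neq0.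
have spanX : span [:: z; 1] = fullv.
  by apply/eqP; rewrite eqEdim subvf (eqP freeX) (proj1 imagK).
have: w \in span [:: z; 1] by rewrite spanX memvf.
rewrite span_cons span_seq1 => /memv_addP[u /vlineP[r ->] [v /vlineP[q ->] ->]].
by exists q, r; rewrite mulr_algl addrC.
Qed.

Lemma sigma_alg q : sigma q%:A = ratr q.
Proof. exact: (fmorph_eq_rat (sigma \o in_alg K)). Qed.

Lemma sigma_intr_inj : injective (intr : int -> K).
Proof.
by move=> m n /(congr1 sigma); rewrite !rmorph_int => /eqP; rewrite eqr_int => /eqP.
Qed.

Lemma natr_neq0 (n : nat) : (0 < n)%N -> n%:R != 0 :> K.
Proof.
move=> n_gt0; apply/eqP => /(@sigma_intr_inj n 0) n0.
by move: n_gt0; lia.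
Qed.

Lemma conjc_sigma_alg q : ((sigma q%:A)^*)%C = sigma q%:A.
Proof.
rewrite sigma_alg -(sigma_alg q).
transitivity (ratr q : R[i]); last by rewrite sigma_alg.
exact: (fmorph_eq_rat (@conjc R \o (sigma \o in_alg K)) q).
Qed.

(** The default 0 of [xget] is harmless: [sigma_conj] shows that a preimage of the complex conjugate
    always exists. *)
Definition kconj z : K := xget 0 [set z' | sigma z' = ((sigma z)^*)%C].

Lemma sigma_conj z : sigma (kconj z) = ((sigma z)^*)%C.
Proof.
suff /(xgetPex 0) : exists z', sigma z' = ((sigma z)^*)%C by [].
have [[q ->]|spanz] := rational_or_spanning z.
  by exists q%:A; rewrite conjc_sigma_alg.
(* z is a root of X^2 - b X - a. The complex conjugate of sigma z is a root as well, hence is sigma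
   z or b - sigma z, and both lie in the image of [sigma]. *)
have [a [b zz]] := spanz (z * z).
have sE : sigma z * sigma z = sigma a%:A + sigma b%:A * sigma z.
  by rewrite -rmorphM zz rmorphD rmorphM.
have cE := congr1 (@conjc R) sE.
rewrite rmorphD !rmorphM /= !conjc_sigma_alg in cE.
have /eqP : (((sigma z)^*)%C - sigma z) *
            (((sigma z)^*)%C + sigma z - sigma b%:A) = 0.
  transitivity ((((sigma z)^*)%C * ((sigma z)^*)%C - (sigma a%:A + sigma b%:A * ((sigma z)^*)%C))
    - (sigma z * sigma z - (sigma a%:A + sigma b%:A * sigma z))); first by ring.
  by rewrite cE sE; ring.
rewrite mulf_eq0 => /orP[] /eqP eq0.
  by exists z; apply/esym/eqP; rewrite -subr_eq0 eq0.
exists (b%:A - z); rewrite rmorphB; apply/esym/eqP.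
by rewrite -subr_eq0 opprB addrA eq0.
Qed.

Lemma kconjD x y : kconj (x + y) = kconj x + kconj y.
Proof. by apply: (fmorph_inj sigma); rewrite rmorphD !sigma_conj !rmorphD. Qed.

Lemma kconjN x : kconj (- x) = - kconj x.
Proof. by apply: (fmorph_inj sigma); rewrite rmorphN !sigma_conj !rmorphN. Qed.

Lemma kconjB x y : kconj (x - y) = kconj x - kconj y.
Proof. by rewrite kconjD kconjN. Qed.

Lemma kconjM x y : kconj (x * y) = kconj x * kconj y.
Proof. by apply: (fmorph_inj sigma); rewrite rmorphM !sigma_conj !rmorphM. Qed.

Lemma kconjK : involutive kconj.
Proof. by move=> x; apply: (fmorph_inj sigma); rewrite !sigma_conj conjcK. Qed.

Lemma kconj_alg q : kconj q%:A = q%:A.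
Proof. by apply: (fmorph_inj sigma); rewrite sigma_conj conjc_sigma_alg. Qed.

Lemma kconj_int m : kconj m%:~R = m%:~R.
Proof. by apply: (fmorph_inj sigma); rewrite sigma_conj !rmorph_int. Qed.

Lemma kconj_nat (n : nat) : kconj n%:R = n%:R.
Proof. exact: (kconj_int n). Qed.

Lemma kconj0 : kconj 0 = 0. Proof. exact: (kconj_nat 0). Qed.

Lemma kconj1 : kconj 1 = 1. Proof. exact: (kconj_nat 1). Qed.

Lemma kconj_eq0 x : (kconj x == 0) = (x == 0).
Proof.
apply/eqP/eqP => [cx0|->]; last exact: kconj0.
by rewrite -(kconjK x) cx0 kconj0.
Qed.

(** Otherwise [sigma] takes real values, and its real part is a ring morphism from K to R. *)
Lemma kconj_nontrivial : exists z, kconj z != z.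
Proof.
apply: contrapT => conj_id; apply: (proj2 imagK).
have Im0 z : complex.Im (sigma z) = 0.
  have : kconj z = z by apply: contrapT => /eqP cz; apply: conj_id; exists z.
  move/(congr1 sigma); rewrite sigma_conj; case: (sigma z) => u v /= [vN].
  by apply/eqP; rewrite -[_ == 0](mulrn_eq0 _ 2) mulr2n -{1}vN addNr.
pose f (z : K) : R := complex.Re (sigma z).
have fK z : (f z)%:C%C = sigma z.
  by rewrite /f; move: (Im0 z); case: (sigma z) => u v /= ->.
have fB : zmod_morphism f.
  by move=> x y; apply: (@complexI R); rewrite rmorphB /= !fK rmorphB.
have fM : monoid_morphism f.
  split=> [|x y]; apply: (@complexI R); first by rewrite fK !rmorph1.
  by rewrite rmorphM /= !fK rmorphM.
exact: (HB.pack_for {rmorphism K -> R} f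
  (GRing.isZmodMorphism.Build K R f fB) (GRing.isMonoidMorphism.Build K R f fM)).
Qed.

(** If an irrational z were fixed, so would be all of K, which 1 and z span. *)
Lemma kconj_fixed z : kconj z = z -> exists q, z = q%:A.
Proof.
move=> cz; have [//|spanz] := rational_or_spanning z.
have [w /eqP[]] := kconj_nontrivial.
have [q [r ->]] := spanz w.
by rewrite kconjD kconjM !kconj_alg cz.
Qed.

(** * Integers of K: rational integers, denominators, an integral basis *)

Lemma OK_int m : OK K m%:~R.
Proof. exact: (integral_id (intr : {rmorphism int -> K})). Qed.

Lemma OK_nat (n : nat) : OK K n%:R. Proof. exact: (OK_int n). Qed.

Lemma OK0 : OK K 0. Proof. exact: (OK_nat 0). Qed.

Lemma OK1 : OK K 1. Proof. exact: (OK_nat 1). Qed.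

Lemma OK_D x y : OK K x -> OK K y -> OK K (x + y).
Proof. exact: (@integral_add _ _ (intr : {rmorphism int -> K})). Qed.

Lemma OK_B x y : OK K x -> OK K y -> OK K (x - y).
Proof. exact: (@integral_sub _ _ (intr : {rmorphism int -> K})). Qed.

Lemma OK_M x y : OK K x -> OK K y -> OK K (x * y).
Proof. exact: (@integral_mul _ _ (intr : {rmorphism int -> K})). Qed.

Lemma OK_conj z : OK K z -> OK K (kconj z).
Proof.
case=> p p_monic pz0; exists p => //.
rewrite -(fmorph_root sigma) -map_poly_comp sigma_conj.
have eqp : map_poly (sigma \o intr) p = map_poly (@conjc R) (map_poly (sigma \o intr) p).
  by rewrite -!map_poly_comp; apply: eq_map_poly => m /=; rewrite !rmorph_int.
by rewrite eqp fmorph_root map_poly_comp fmorph_root.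
Qed.

(** The integral equation of q is moved from K to Q and on to [algC], where a rational algebraic
    integer is known to lie in Z. *)
Lemma OK_rational q : OK K q%:A -> exists m, q%:A = m%:~R :> K.
Proof.
case=> p p_monic pq0.
have /intrP[m qm] : ratr q \in (Num.int : {pred algC}).
  apply: Cint_rat_Aint; first exact: Crat_rat.
  apply: (@root_monic_Aint (map_poly intr p)); first last.
  - by apply/polyOverP => i; rewrite coef_map /= intr_int.
  - exact: monic_map.
  have eqL : map_poly (intr : int -> algC) p =
             map_poly (ratr : rat -> algC) (map_poly intr p).
    by rewrite -map_poly_comp; apply: eq_map_poly => i /=; rewrite ratr_int.
  rewrite eqL fmorph_root -(fmorph_root (in_alg K)) -map_poly_comp.
  suff -> : map_poly (in_alg K \o intr) p = map_poly intr p by [].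
  by apply: eq_map_poly => i /=; rewrite scaler_int.
exists m; have -> : q = m%:~R by apply: (fmorph_inj (ratr : {rmorphism rat -> algC})); rewrite /= ratr_int.
by rewrite scaler_int.
Qed.

Lemma OK_fixed z : OK K z -> kconj z = z -> exists m, z = m%:~R.
Proof. by move=> zO /kconj_fixed[q zq]; rewrite zq in zO *; apply: OK_rational. Qed.

(** The integrality test behind the Gauss lemma: z is a root of X^2 - m X + n. *)
Lemma OK_quadratic z m n :
  z + kconj z = m%:~R -> z * kconj z = n%:~R -> OK K z.
Proof.
move=> tr_z nm_z; exists ('X^2 - (m%:P * 'X - n%:P)).
  rewrite monicE lead_coefDl ?lead_coefXn // size_polyXn size_polyN.
  rewrite (leq_ltn_trans (size_polyD _ _)) // size_polyN gtn_max.
  rewrite (leq_ltn_trans (size_polyMleq _ _)) ?(leq_ltn_trans (size_polyC_leq1 _)) //.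
  by rewrite size_polyX addn2 /= !ltnS size_polyC_leq1.
rewrite /root !rmorphB rmorphXn rmorphM /= map_polyX !map_polyC /= !hornerE.
by rewrite -tr_z -nm_z; apply/eqP; ring.
Qed.

Lemma OK_denominator z : exists2 d : nat, (0 < d)%N & OK K (d%:R * z).
Proof.
have [t tr_z] : exists q, z + kconj z = q%:A.
  by apply: kconj_fixed; rewrite kconjD kconjK addrC.
have [n nm_z] : exists q, z * kconj z = q%:A.
  by apply: kconj_fixed; rewrite kconjM kconjK mulrC.
have algE q (k : int) : (k%:~R * q)%:A = k%:~R * q%:A :> K.
  by rewrite -scalerA scaler_int mulrzl.
have denE q : exists m, ((denq q)%:~R * q)%:A = m%:~R :> K.
  exists (numq q); rewrite mulrC -{1}(divq_num_den q) divfK ?intr_eq0 ?denq_neq0 //.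
  by rewrite scaler_int.
have [mt tE] := denE t; have [mn nE] := denE n; rewrite !algE -tr_z in tE.
rewrite algE -nm_z in nE.
(* With D this product, D z has trace D t and norm D^2 n, and both are integers. *)
exists (`|denq t| * `|denq n|)%N; first by rewrite muln_gt0 !absz_gt0 !denq_neq0.
have -> : (`|denq t| * `|denq n|)%:R = (denq t * denq n)%:~R :> K.
  by rewrite pmulrn PoszM !absz_denq.
apply: (@OK_quadratic _ (mt * denq n) (mn * denq t * denq t * denq n)).
  by rewrite kconjM kconj_int !rmorphM /= -tE; ring.
by rewrite kconjM kconj_int !rmorphM /= -nE; ring.
Qed.

Lemma OK_fraction z : exists x y, [/\ OK K x, OK K y, y != 0 & z = x / y].
Proof.
have [d d_gt0 dz] := OK_denominator z.
exists (d%:R * z), d%:R; split=> //; [exact: OK_nat | exact: natr_neq0|].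
by field; exact: natr_neq0.
Qed.

(* With [delta] an integer of trace 0, [z |-> (z - kconj z) * delta] maps the
   ring of integers to Z with kernel Z, so it suffices to lift a generator of
   the image. *)
Lemma OK_basis : exists w : K,
  [/\ OK K w, forall z, OK K z -> exists m n, z = m%:~R + n%:~R * w &
      forall m n, m%:~R + n%:~R * w = 0 -> m = 0 /\ n = 0].
Proof.
have [z0 cz0] := kconj_nontrivial.
have [d d_gt0 dz] := OK_denominator (z0 - kconj z0).
set delta := d%:R * _ in dz.
have delta_neq0 : delta != 0.
  by rewrite mulf_neq0 ?natr_neq0 // subr_eq0 eq_sym.
have c_delta : kconj delta = - delta.
  by rewrite kconjM kconj_nat kconjB kconjK -mulrN opprB.
have imO z : OK K z -> exists n, (z - kconj z) * delta = n%:~R.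
  move=> zO; apply: OK_fixed; first by apply/OK_M/dz/OK_B/OK_conj.
  by rewrite kconjM c_delta kconjB kconjK mulrN -mulNr opprB.
pose S : set int := [set n | exists2 z, OK K z & (z - kconj z) * delta = n%:~R].
have [] := @int_subgroup_principal S.
- move=> m n [x xO xm] [y yO yn]; exists (x - y); first exact: OK_B.
  by rewrite rmorphB /= -xm -yn kconjB; ring.
- have [n nE] := imO _ dz; exists n; first by exists delta.
  apply: contra_neq delta_neq0 => n0; apply/eqP.
  move/eqP: nE; rewrite n0 c_delta opprK -mulr2n mulf_eq0 mulr2n -mulr2n.
  by rewrite -mulr_natl mulf_eq0 (negPf (natr_neq0 _)) // orbb.
move=> n [n_gt0 [w wO wn] n_dvd]; exists w; split=> //.
  move=> z zO; have [k kE] := imO z zO.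
  have /dvdzP[j jE] := n_dvd _ (ex_intro2 _ _ _ zO kE).
  have [||i iE] := @OK_fixed (z - j%:~R * w); first exact/OK_B/OK_M/wO/OK_int.
    apply/eqP; rewrite -subr_eq0 -(inj_eq (mulIf delta_neq0)) mul0r.
    rewrite kconjB kconjM kconj_int; apply/eqP.
    transitivity (j%:~R * ((w - kconj w) * delta) - (z - kconj z) * delta); first by ring.
    by rewrite kE wn jE rmorphM subrr.
  by exists i, j; rewrite -iE; ring.
move=> i j ij0; have j0 : j = 0.
  apply/eqP; rewrite -(inj_eq sigma_intr_inj) -(inj_eq (mulIf (natr_neq0 n_gt0))).
  rewrite mul0r pmulrn -wn; apply/eqP.
  transitivity ((i%:~R + j%:~R * w - kconj (i%:~R + j%:~R * w)) * delta).
    by rewrite kconjD kconjM !kconj_int; ring.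
  by rewrite ij0 kconj0 subrr mul0r.
by split=> //; apply: sigma_intr_inj; move: ij0; rewrite j0 mulr0z mul0r addr0.
Qed.

(** The norm from K to Q, as a natural number. On integers the value exists, being both a rational
    integer and the square of a complex modulus. *)
Definition knorm z : nat := xget 0%N [set n : nat | z * kconj z = n%:R].

Lemma sigma_norm z : sigma (z * kconj z) = (Normc.normc (sigma z) ^+ 2)%:C%C.
Proof.
rewrite rmorphM sigma_conj -sqr_normc normc_def rmorphXn /=.
by case: (sigma z).
Qed.

Lemma knormE z : OK K z -> z * kconj z = (knorm z)%:R.
Proof.
move=> zO; suff /(xgetPex 0%N) : exists n : nat, z * kconj z = n%:R by [].
have [||m mE] := @OK_fixed (z * kconj z); first exact/OK_M/OK_conj.
  by rewrite kconjM kconjK mulrC.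
have := sigma_norm z; rewrite mE rmorph_int -(rmorph_int (real_complex R)) => /complexI mR.
 have : 0 <= m%:~R :> R.
  by have := sqr_ge0 (Normc.normc (sigma z)); rewrite -mR.
by rewrite ler0z; case: m {mE mR} => // n _; exists n.
Qed.

End ImaginaryQuadratic.

(** * Ideals and their inverses *)

Section IntegralIdeals.
Variable K : fieldExtType rat.
Implicit Types (I J L : set K) (x y z : K).

Definition nonzero_ideal I : Prop := exists2 x, I x & x != 0.

Lemma ideal_OK I x : integral_ideal I -> I x -> OK K x.
Proof. by case=> IO _ _ _; apply: IO. Qed.

Lemma ideal0 I : integral_ideal I -> I 0. Proof. by case. Qed.

Lemma idealD I x y : integral_ideal I -> I x -> I y -> I (x + y).
Proof. by case=> _ _ + _; apply. Qed.

Lemma idealMl I a x : integral_ideal I -> OK K a -> I x -> I (a * x).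
Proof. by case=> _ _ _; apply. Qed.

Lemma idealN I x : integral_ideal I -> I x -> I (- x).
Proof. by move=> idI Ix; rewrite -mulN1r; apply: idealMl Ix => //; apply: (OK_int _ (-1)). Qed.

Lemma idealB I x y : integral_ideal I -> I x -> I y -> I (x - y).
Proof. by move=> idI Ix Iy; apply: (idealD idI) => //; apply: idealN. Qed.

Lemma integral_ideal_OK : integral_ideal (OK K).
Proof. by split=> //; [exact: OK0 | exact: OK_D | exact: OK_M]. Qed.

Lemma ideal_with1 I : integral_ideal I -> I 1 -> I = OK K.
Proof.
move=> idI I1; apply/seteqP; split=> x; first exact: ideal_OK.
by move=> xO; rewrite -[x]mulr1; apply: idealMl.
Qed.

Lemma integral_ideal_gen (S : set K) : S `<=` OK K -> integral_ideal (ideal_gen S).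
Proof.
move=> SO; split=> [|I [idI _]|x y Sx Sy I IP|a x aO Sx I IP].
- by apply: smallest_sub => //; apply: integral_ideal_OK.
- exact: ideal0.
- by apply: idealD (proj1 IP) _ _; [apply: Sx | apply: Sy].
- by apply: idealMl (proj1 IP) aO _; apply: Sx.
Qed.

Lemma integral_ideal_gen1 x : OK K x -> integral_ideal (ideal_gen [set x]).
Proof. by move=> xO; apply: integral_ideal_gen => _ ->. Qed.

Lemma integral_ideal_gen2 x y :
  OK K x -> OK K y -> integral_ideal (ideal_gen [set x; y]).
Proof. by move=> xO yO; apply: integral_ideal_gen => _ [] ->. Qed.

Lemma mem_gen1 x : ideal_gen [set x] x.
Proof. exact: sub_gen_smallest. Qed.

Lemma mem_gen2l x y : ideal_gen [set x; y] x.
Proof. by apply: sub_gen_smallest; left. Qed.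

Lemma mem_gen2r x y : ideal_gen [set x; y] y.
Proof. by apply: sub_gen_smallest; right. Qed.

Lemma gen1_subset x I : integral_ideal I -> I x -> ideal_gen [set x] `<=` I.
Proof. by move=> idI Ix; apply: smallest_sub => // _ ->. Qed.

Lemma gen2_subset x y I :
  integral_ideal I -> I x -> I y -> ideal_gen [set x; y] `<=` I.
Proof. by move=> idI Ix Iy; apply: smallest_sub => // _ [] ->. Qed.

Lemma integral_ideal_dilate x I :
  OK K x -> integral_ideal I -> integral_ideal (dilate x I).
Proof.
move=> xO idI; split=> [_ [y Iy <-]||_ _ [y Iy <-] [z Iz <-]|a _ aO [y Iy <-]].
- exact/OK_M/ideal_OK/Iy.
- by exists 0; [exact: ideal0 | rewrite mulr0].
- by exists (y + z); [exact: idealD | rewrite mulrDr].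
- by exists (a * y); [exact: idealMl | rewrite mulrCA].
Qed.

Lemma gen1E x : OK K x -> ideal_gen [set x] = dilate x (OK K).
Proof.
move=> xO; apply/seteqP; split.
  apply: gen1_subset; first exact/integral_ideal_dilate/integral_ideal_OK.
  by exists 1; rewrite ?mulr1 //; exact: OK1.
move=> _ [a aO <-]; rewrite mulrC.
exact (idealMl (integral_ideal_gen1 xO) aO (@mem_gen1 x)).
Qed.

Lemma gen1_1 : ideal_gen [set 1] = OK K.
Proof. exact (ideal_with1 (integral_ideal_gen1 (OK1 K)) (@mem_gen1 1)). Qed.

Lemma dilate_subset x I J : x != 0 -> dilate x I `<=` dilate x J -> I `<=` J.
Proof.
move=> x_neq0 sub y Iy; have [|z Jz] := sub (x * y); first by exists y.
by move/(mulfI x_neq0) <-.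
Qed.

Lemma nonzero_gen1 x : x != 0 -> nonzero_ideal (ideal_gen [set x]).
Proof. by exists x; [exact: mem_gen1|]. Qed.

Lemma integral_ideal_mul I J :
  integral_ideal I -> integral_ideal J -> integral_ideal (ideal_mul I J).
Proof.
move=> idI idJ; apply: integral_ideal_gen => _ [x [y [Ix Jy ->]]].
by apply: OK_M; [exact: ideal_OK Ix | exact: ideal_OK Jy].
Qed.

Lemma mem_ideal_mul I J x y : I x -> J y -> ideal_mul I J (x * y).
Proof. by move=> Ix Jy; apply: sub_gen_smallest; exists x, y. Qed.

Lemma ideal_mul_subset I J L : integral_ideal L ->
  (forall x y, I x -> J y -> L (x * y)) -> ideal_mul I J `<=` L.
Proof.
by move=> idL IJL; apply: smallest_sub => // _ [x [y [Ix Jy ->]]]; apply: IJL.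
Qed.

Lemma ideal_mulC I J : ideal_mul I J = ideal_mul J I.
Proof.
rewrite /ideal_mul; congr (ideal_gen _); apply/seteqP.
by split=> _ [x [y [Ix Jy ->]]]; exists y, x; rewrite mulrC.
Qed.

(** The colon ideal of L by x. It reduces a claim on x * u, for u in a generated ideal, to the
    generators; it also builds quotients of ideals and shows that maximal ideals are prime. *)
Lemma integral_ideal_colon L x :
  OK K x -> integral_ideal L -> integral_ideal [set u | OK K u /\ L (x * u)].
Proof.
move=> xO idL; split=> [u [] //||u v [uO Lu] [vO Lv]|a u aO [uO Lu]].
- by split; [exact: OK0 | rewrite mulr0; exact: ideal0].
- by split; [exact: OK_D | rewrite mulrDr; exact: idealD].
- by split; [exact: OK_M | rewrite mulrCA; exact: idealMl].
Qed.

Lemma ideal_mulA I J L : integral_ideal I -> integral_ideal J ->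
  integral_ideal L -> ideal_mul I (ideal_mul J L) = ideal_mul (ideal_mul I J) L.
Proof.
have half (A B C : set K) : integral_ideal A -> integral_ideal B -> integral_ideal C ->
    ideal_mul A (ideal_mul B C) `<=` ideal_mul (ideal_mul A B) C.
  move=> idA idB idC; have idABC := integral_ideal_mul (integral_ideal_mul idA idB) idC.
  apply: ideal_mul_subset => // x u Ax BCu.
  have xO := ideal_OK idA Ax.
  suff /(_ u BCu)[] : ideal_mul B C `<=`
    [set u | OK K u /\ ideal_mul (ideal_mul A B) C (x * u)] by [].
  apply: ideal_mul_subset => [|y z By Cz]; first exact: integral_ideal_colon.
  split; first by apply: OK_M; [exact: ideal_OK By | exact: ideal_OK Cz].
  by rewrite mulrA; apply: mem_ideal_mul => //; apply: mem_ideal_mul.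
move=> idI idJ idL; apply/seteqP; split; first exact: half.
(* The reverse inclusion is the same one, read through commutativity. *)
rewrite [ideal_mul _ L]ideal_mulC (ideal_mulC I J) (ideal_mulC I) (ideal_mulC J L).
exact: half.
Qed.

Lemma ideal_mulCA I J L : integral_ideal I -> integral_ideal J ->
  integral_ideal L -> ideal_mul I (ideal_mul J L) = ideal_mul J (ideal_mul I L).
Proof. by move=> idI idJ idL; rewrite !ideal_mulA // (ideal_mulC I). Qed.

Lemma ideal_mulS I J L : integral_ideal I -> integral_ideal L ->
  J `<=` L -> ideal_mul I J `<=` ideal_mul I L.
Proof.
move=> idI idL JL; apply: ideal_mul_subset; first exact: integral_ideal_mul.
by move=> x y Ix Jy; apply: mem_ideal_mul => //; apply: JL.
Qed.

Lemma ideal_mul_subl I J :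
  integral_ideal I -> integral_ideal J -> ideal_mul I J `<=` I.
Proof.
move=> idI idJ; apply: ideal_mul_subset => // x y Ix Jy.
by rewrite mulrC; apply: idealMl => //; exact: ideal_OK Jy.
Qed.

Lemma gen1_mul x I : OK K x -> integral_ideal I ->
  ideal_mul (ideal_gen [set x]) I = dilate x I.
Proof.
move=> xO idI; apply/seteqP; split; last first.
  by move=> _ [y Iy <-]; apply: mem_ideal_mul => //; apply: mem_gen1.
apply: ideal_mul_subset => [|u y]; first exact: integral_ideal_dilate.
rewrite gen1E // => -[a aO <-] Iy.
by exists (a * y); [exact: idealMl | rewrite mulrA].
Qed.

Lemma ideal_mul1 I : integral_ideal I -> ideal_mul (OK K) I = I.
Proof.
move=> idI; rewrite -gen1_1 gen1_mul //; last exact: OK1.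
apply/seteqP; split=> [_ [y Iy <-]|y Iy]; first by rewrite mul1r.
by exists y; rewrite ?mul1r.
Qed.

Lemma gen1_mul_gen1 x y : OK K x -> OK K y ->
  ideal_mul (ideal_gen [set x]) (ideal_gen [set y]) = ideal_gen [set x * y].
Proof.
move=> xO yO; rewrite gen1_mul //; last exact: integral_ideal_gen1.
rewrite !gen1E //; last exact: OK_M.
apply/seteqP; split=> [_ [_ [a aO <-] <-]|_ [a aO <-]].
  by exists a; rewrite ?mulrA.
by exists (y * a); [exists a | rewrite mulrA].
Qed.

Lemma nonzero_mul I J :
  nonzero_ideal I -> nonzero_ideal J -> nonzero_ideal (ideal_mul I J).
Proof.
move=> [x Ix x0] [y Jy y0]; exists (x * y); first exact: mem_ideal_mul.
exact: mulf_neq0.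
Qed.

Lemma nonzero_mul_l I J : integral_ideal I -> integral_ideal J ->
  nonzero_ideal (ideal_mul I J) -> nonzero_ideal I.
Proof. by move=> idI idJ [x IJx x0]; exists x => //; apply: ideal_mul_subl IJx. Qed.

Lemma nonzero_OK : nonzero_ideal (OK K).
Proof. by exists 1; [exact: OK1 | exact: oner_neq0]. Qed.

End IntegralIdeals.

(** * The Gauss lemma, cancellation and divisibility of ideals *)

Section IdealInverse.
Variables (R : realType) (K : fieldExtType rat) (sigma : {rmorphism K -> R[i]}).
Hypothesis imagK : imaginary_quadratic R K.
Implicit Types (I J L : set K) (x y z : K).
Local Notation conj := (kconj sigma).

Definition ideal_conj I : set K := [set x | I (conj x)].

Lemma integral_ideal_conj I : integral_ideal I -> integral_ideal (ideal_conj I).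
Proof.
move=> idI; split=> [x Ix||x y Ix Iy|a x aO Ix]; rewrite /ideal_conj /=.
- by rewrite -(kconjK sigma imagK x); apply/OK_conj/ideal_OK/Ix.
- by rewrite kconj0 //; apply: ideal0.
- by rewrite kconjD //; apply: idealD.
- by rewrite kconjM //; apply: idealMl => //; apply: OK_conj.
Qed.

(* The Gauss lemma: with [n] generating the integers of I * conj I, every
   [x * conj y / n] has integral trace and norm. *)
Lemma ideal_mul_conj I : integral_ideal I -> nonzero_ideal I ->
  exists2 n : nat, (0 < n)%N & ideal_mul I (ideal_conj I) = ideal_gen [set n%:R].
Proof.
move=> idI [x0 Ix0 x0_neq0]; set C := ideal_mul _ _.
have idC : integral_ideal C by apply/integral_ideal_mul/integral_ideal_conj.
have Cmem x y : I x -> I y -> C (x * conj y).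
  by move=> Ix Iy; apply: mem_ideal_mul => //; rewrite /ideal_conj /= kconjK.
have nm x : I x -> exists m : int, x * conj x = m%:~R /\ C m%:~R.
  move=> Ix; have xO := ideal_OK idI Ix.
  have [||m mE] := @OK_fixed _ _ sigma imagK (x * conj x).
  - exact/OK_M/OK_conj.
  - by rewrite kconjM // kconjK // mulrC.
  by exists m; split; rewrite -?mE //; apply: Cmem.
have [] := @int_subgroup_principal [set m : int | C m%:~R].
- by move=> m n Cm Cn; rewrite /= rmorphB; apply: (idealB idC).
- have [m [mE Cm]] := nm _ Ix0; exists m => //.
  apply/eqP => m0; move/eqP: mE.
  by rewrite m0 mulr0z mulf_eq0 kconj_eq0 // orbb (negPf x0_neq0).
move=> n [n_gt0 Cn n_dvd]; exists n => //.
have n_neq0 := natr_neq0 sigma n_gt0.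
apply/seteqP; split; last exact: gen1_subset.
apply: ideal_mul_subset => [|x y']; first exact/integral_ideal_gen1/OK_nat.
rewrite -(kconjK sigma imagK y') /ideal_conj /= kconjK //.
move: (conj y') => y Ix Iy; have [xO yO] := (ideal_OK idI Ix, ideal_OK idI Iy).
have [mx [mxE /n_dvd/dvdzP[kx kxE]]] := nm _ Ix.
have [my [myE /n_dvd/dvdzP[ky kyE]]] := nm _ Iy.
have [||t tE] := @OK_fixed _ _ sigma imagK (x * conj y + y * conj x).
- by apply: OK_D; apply: OK_M => //; apply: OK_conj.
- by rewrite kconjD // !kconjM // !kconjK //; ring.
have /n_dvd/dvdzP[kt ktE] : C t%:~R by rewrite -tE; apply: (idealD idC); apply: Cmem.
rewrite gen1E; last exact: OK_nat.
exists (x * conj y / n%:R); last by rewrite mulrCA divff ?mulr1.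
have cE : conj (x * conj y / n%:R) = y * conj x / n%:R.
  have cn := kconj_nat sigma imagK n.
  apply: (mulIf n_neq0); rewrite -{2}cn -kconjM // !divfK //.
  by rewrite kconjM // kconjK // mulrC.
apply: (@OK_quadratic _ _ sigma _ kt (kx * ky)); rewrite cE.
  by rewrite -mulrDl tE ktE rmorphM /= -pmulrn mulfK.
transitivity ((x * conj x) * (y * conj y) / (n%:R * n%:R)); first by field.
by rewrite mxE myE kxE kyE !rmorphM /= -pmulrn; field.
Qed.

Lemma ideal_inverse I : integral_ideal I -> nonzero_ideal I ->
  exists J, exists2 n : nat, (0 < n)%N &
    integral_ideal J /\ ideal_mul J I = ideal_gen [set n%:R].
Proof.
move=> idI nzI; have [n n_gt0 nE] := ideal_mul_conj idI nzI.
exists (ideal_conj I), n => //; rewrite ideal_mulC nE; split=> //.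
exact: integral_ideal_conj.
Qed.

(** Multiplying by I' with I' I = (n) turns the factor I into the integer n, which cancels
    elementwise. *)
Lemma ideal_mul_subsetl I J L :
  integral_ideal I -> integral_ideal J -> integral_ideal L ->
  nonzero_ideal I -> ideal_mul I J `<=` ideal_mul I L -> J `<=` L.
Proof.
move=> idI idJ idL nzI IJL; have [I' [n n_gt0 [idI' nE]]] := ideal_inverse idI nzI.
apply: (dilate_subset (natr_neq0 sigma n_gt0)).
rewrite -!gen1_mul //; try exact: OK_nat.
rewrite -nE -!ideal_mulA //; apply: ideal_mulS => //.
exact: integral_ideal_mul.
Qed.

Lemma ideal_mul_injl I J L :
  integral_ideal I -> integral_ideal J -> integral_ideal L ->
  nonzero_ideal I -> ideal_mul I J = ideal_mul I L -> J = L.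
Proof.
move=> idI idJ idL nzI IJL.
by apply/seteqP; split; apply: (ideal_mul_subsetl idI) => //; rewrite IJL.
Qed.

(** To contain is to divide. With I' I = (n) the quotient is I' J / n, written as a colon ideal; n
    divides every element of I' J because I' J lies in I' I. *)
Lemma ideal_dvd I J : integral_ideal I -> integral_ideal J -> nonzero_ideal I ->
  J `<=` I -> exists2 L, integral_ideal L & J = ideal_mul I L.
Proof.
move=> idI idJ nzI JI; have [I' [n n_gt0 [idI' nE]]] := ideal_inverse idI nzI.
have nO := OK_nat K n; have n_neq0 := natr_neq0 sigma n_gt0.
have idI'J := integral_ideal_mul idI' idJ.
set L := [set u | OK K u /\ ideal_mul I' J (n%:R * u)].
have idL : integral_ideal L by apply: integral_ideal_colon.
have nL : dilate n%:R L = ideal_mul I' J.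
  apply/seteqP; split=> [_ [u [] _ ? <-] //|u I'Ju].
  have : ideal_gen [set n%:R] u by rewrite -nE; apply: ideal_mulS I'Ju.
  by rewrite gen1E // => -[v vO vE]; exists v => //; split; rewrite ?vE.
exists L => //; apply: (ideal_mul_injl (integral_ideal_gen1 nO)) => //.
- exact: integral_ideal_mul.
- exact: nonzero_gen1.
rewrite ideal_mulCA //; last exact: integral_ideal_gen1.
rewrite [ideal_mul _ L]gen1_mul // nL ideal_mulA // (ideal_mulC I) nE //.
Qed.

End IdealInverse.

(** * Residue systems and ideal norms *)

Section ResidueSystems.
Variable K : fieldExtType rat.
Implicit Types A B C I : set K.

Definition additive_subgroup A : Prop := A 0 /\ forall x y, A x -> A y -> A (x - y).

Lemma subgroupN A x : additive_subgroup A -> A x -> A (- x).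
Proof. by case=> A0 AB Ax; rewrite -sub0r; apply: AB. Qed.

Lemma subgroupD A x y : additive_subgroup A -> A x -> A y -> A (x + y).
Proof. by move=> sA Ax Ay; rewrite -[y]opprK; apply: (proj2 sA) => //; apply: subgroupN. Qed.

Lemma ideal_subgroup I : integral_ideal I -> additive_subgroup I.
Proof. by move=> idI; split=> [|x y]; [exact: ideal0 | exact: idealB]. Qed.

(** A system of representatives of A modulo B; the cardinal of [T] is the index. *)
Definition residue_system A B (T : finType) (c : T -> K) : Prop :=
  (forall t, A (c t)) /\ forall y, A y -> exists! t, B (y - c t).

Lemma residue_inj A B (T : finType) (c : T -> K) s t :
  residue_system A B c -> B 0 -> B (c s - c t) -> s = t.
Proof.
move=> [Ac sys] B0 Bst; have [u [_ uU]] := sys _ (Ac s).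
by rewrite -(uU s) ?subrr // (uU t).
Qed.

Lemma ideal_normE I (T : finType) (c : T -> K) :
  integral_ideal I -> residue_system (OK K) I c -> ideal_norm I = #|T|.
Proof.
move=> idI sys; have sI := ideal_subgroup idI; have [cO cP] := sys.
pose f t : set K := [set y | OK K y /\ I (y - c t)].
have f_inj : injective f.
  move=> s t fst; apply: (residue_inj sys) => //; first exact: ideal0.
  by have [] : f t (c s) by rewrite -fst; split=> //; rewrite subrr; apply: ideal0.
rewrite /ideal_norm.
have -> : residues I = [set` [fset f t | t in T]%fset].
  apply/seteqP; split=> [_ [x xO <-]|_ /imfsetP[t _ ->]].
    have [t [Ixt _]] := cP x xO; apply/imfsetP; exists t => //=.
    apply/seteqP; split=> y [yO Iy]; split=> //.
      by rewrite -(subrKA x); apply: (subgroupD sI).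
    rewrite -(subrKA (c t)); apply: (subgroupD sI) => //.
    by rewrite -opprB; apply: (subgroupN sI).
  by exists (c t); [exact: cO|].
by rewrite set_fsetK card_imfset //= -cardE.
Qed.

(** Multiplicativity of the index: y is reduced modulo B, then the remainder modulo C. *)
Lemma residue_tower A B C (T T' : finType) (c : T -> K) (d : T' -> K) :
  additive_subgroup A -> additive_subgroup B -> additive_subgroup C ->
  C `<=` B -> B `<=` A -> residue_system A B c -> residue_system B C d ->
  residue_system A C (fun p : T * T' => c p.1 + d p.2).
Proof.
move=> sA sB sC CB BA [Ac cP] [Bd dP]; split=> [p|y Ay].
  by apply: (subgroupD sA) => //; apply: BA.
have [t [Bt tU]] := cP y Ay; have [t' [Ct' t'U]] := dP _ Bt.
exists (t, t'); split=> [|[s s'] /= Cs]; first by rewrite /= opprD addrA.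
have ts : t = s.
  apply: tU; rewrite -(subrK (d s') (y - c s)).
  by apply: (subgroupD sB) => //; apply: CB; rewrite -addrA -opprD.
by rewrite {}ts in t'U *; congr pair; apply: t'U; rewrite -addrA -opprD.
Qed.

Lemma residue_image A B (T : finType) (c : T -> K) (f : K -> K) :
  injective f -> {morph f : x y / x - y} ->
  residue_system A B c -> residue_system (f @` A) (f @` B) (f \o c).
Proof.
move=> f_inj fB [Ac cP]; split=> [t|_ [y Ay <-]]; first by exists (c t).
have [t [Bt tU]] := cP y Ay; exists t; split=> [|s [z Bz]].
  by exists (y - c t).
by rewrite /= -fB => /f_inj zE; apply: tU; rewrite -zE.
Qed.

(** Finiteness is inherited from O_K modulo B: every coset of C that meets A is the coset of some c
    t. New representatives are then chosen inside A. *)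
Lemma residue_system_sub A B C (T : finType) (c : T -> K) :
  additive_subgroup C -> residue_system (OK K) B c -> A `<=` OK K -> B `<=` C ->
  exists m (d : 'I_m -> K), residue_system A C d.
Proof.
move=> sC [cO cP] AO BC.
pose coset x : set K := [set y | C (y - x)].
have cosetP x y : C (x - y) <-> coset x = coset y.
  split=> [Cxy|xy]; last by rewrite -[C _]/(coset y x) -xy /coset /= subrr; exact: sC.1.
  apply/seteqP; split=> z Cz; rewrite /coset /=.
    by rewrite -(subrKA x); apply: (subgroupD sC).
  rewrite -(subrKA y); apply: (subgroupD sC) => //.
  by rewrite -opprB; apply: (subgroupN sC).
have : finite_set (coset @` A).
  apply: (@sub_finite_set _ _ ((coset \o c) @` [set: T])); last first.
    exact/finite_image/finite_finset.
  move=> _ [x Ax <-]; have [t [Bt _]] := cP x (AO _ Ax).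
  by exists t => //; apply/esym/cosetP/BC.
case/finite_seqP => s0 s0E; pose s := undup s0.
have sE X : (X \in s) <-> exists2 x, A x & coset x = X.
  rewrite mem_undup; have -> : (X \in s0) = ([set` s0] X) :> Prop by [].
  by rewrite -s0E; split=> -[x]; exists x.
have dP (i : 'I_(size s)) : exists x, A x /\ coset x = nth set0 s i.
  have [|x Ax xE] := (sE (nth set0 s i)).1; first exact: mem_nth.
  by exists x.
exists (size s), (fun i => sval (cid (dP i))).
have dE i : A (sval (cid (dP i))) /\ coset (sval (cid (dP i))) = nth set0 s i.
  exact: svalP (cid (dP i)).
split=> [i|y Ay]; first exact: (dE i).1.
have ys : coset y \in s by apply/sE; exists y.
have ylt : (index (coset y) s < size s)%N by rewrite index_mem.
exists (Ordinal ylt); split=> [|i /cosetP yi]; first by apply/cosetP; rewrite (dE _).2 nth_index.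
apply: val_inj; rewrite /= yi (dE i).2 index_uniq //; exact: undup_uniq.
Qed.

Lemma residue_trivial A B (T : finType) (c : T -> K) : additive_subgroup A ->
  additive_subgroup B -> residue_system A B c -> (#|T| <= 1)%N -> A `<=` B.
Proof.
move=> sA sB [Ac cP] T1 y Ay.
have [t [Bt _]] := cP y Ay; have [t' [Bt' _]] := cP 0 sA.1.
have tt : t' = t by apply: (fintype_le1P T1).
by rewrite tt in Bt'; have := proj2 sB _ _ Bt Bt'; rewrite sub0r opprK subrK.
Qed.

End ResidueSystems.

(** * Multiplicativity of the ideal norm and factorization into maximal ideals *)

Section IdealNorm.
Variables (R : realType) (K : fieldExtType rat) (sigma : {rmorphism K -> R[i]}).
Hypothesis imagK : imaginary_quadratic R K.
Implicit Types (I J L P : set K) (x y z : K).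
Local Notation conj := (kconj sigma).

(** In the coordinates of an integral basis 1, w, the quotient of O_K by (n) is (Z/n)^2; hence (n)
    has norm n^2. *)
Lemma residue_system_nat (n : nat) : (0 < n)%N ->
  exists c : 'I_n * 'I_n -> K, residue_system (OK K) (ideal_gen [set n%:R]) c.
Proof.
move=> n_gt0; have [w [wO w_span w_free]] := OK_basis sigma imagK.
have nO := OK_nat K n.
have modP (m : int) : exists i : 'I_n, (n %| m - i%:Z)%Z /\
    forall j : 'I_n, (n %| m - j%:Z)%Z -> i = j.
  have lt_mod : (`|(m %% n)%Z| < n)%N 
    by have := @modz_ge0 m n; have := @ltz_pmod m n; lia.
  have modE : `|(m %% n)%Z|%N%:Z = (m %% n)%Z by apply: gez0_abs; apply: modz_ge0; lia.
  exists (Ordinal lt_mod); split=> [|j /=].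
    by rewrite /= modE {1}(divz_eq m n) addrK dvdz_mull.
  rewrite -eqz_mod_dvd => /eqP mj; apply: val_inj => /=.
  by rewrite mj modz_small // ltz_nat ltn_ord.
have genE m k : ideal_gen [set n%:R] (m%:~R + k%:~R * w) <->
    (n %| m)%Z /\ (n %| k)%Z.
  rewrite gen1E //; split=> [[z zO]|[/dvdzP[m' ->] /dvdzP[k' ->]]].
    have [m' [k' ->]] := w_span z zO => zE.
    have [] := w_free (m - n%:Z * m') (k - n%:Z * k').
      rewrite !rmorphB !rmorphM /= -pmulrn.
      transitivity ((m%:~R + k%:~R * w) - n%:R * (m'%:~R + k'%:~R * w)); first by ring.
      by rewrite zE subrr.
    by move=> /subr0_eq -> /subr0_eq ->; rewrite !dvdz_mulr.
  exists (m'%:~R + k'%:~R * w); first exact/OK_D/OK_M/wO/OK_int/OK_int.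
  by rewrite !rmorphM /= -pmulrn; ring.
exists (fun p : 'I_n * 'I_n => p.1%:R + p.2%:R * w); split=> [p|y yO].
  exact/OK_D/OK_M/wO/OK_nat/OK_nat.
have [m [k ->]] := w_span y yO.
have subE (p : 'I_n * 'I_n) : m%:~R + k%:~R * w - (p.1%:R + p.2%:R * w) =
    (m - p.1%:Z)%:~R + (k - p.2%:Z)%:~R * w.
  by rewrite !rmorphB /= -!pmulrn; ring.
have [i [im iU]] := modP m; have [j [jk jU]] := modP k.
exists (i, j); split=> [|[i' j']]; first by rewrite subE; apply/genE.
by rewrite subE => /genE[/iU -> /jU ->].
Qed.

Lemma ideal_int I : integral_ideal I -> nonzero_ideal I ->
  exists2 n : nat, (0 < n)%N & I n%:R.
Proof.
move=> idI nzI; have [J [n n_gt0 [idJ nE]]] := ideal_inverse sigma imagK idI nzI.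
exists n => //; have := @mem_gen1 K n%:R; rewrite -nE ideal_mulC.
exact: ideal_mul_subl.
Qed.

Lemma residue_system_ideal I J :
  integral_ideal I -> integral_ideal J -> nonzero_ideal J ->
  exists m (c : 'I_m -> K), residue_system I J c.
Proof.
move=> idI idJ nzJ; have [n n_gt0 Jn] := ideal_int idJ nzJ.
have [c sys] := residue_system_nat n_gt0.
apply: (residue_system_sub (ideal_subgroup idJ) sys); first by case: idI.
exact: gen1_subset.
Qed.

Lemma ideal_norm_system I : integral_ideal I -> nonzero_ideal I ->
  exists c : 'I_(ideal_norm I) -> K, residue_system (OK K) I c.
Proof.
move=> idI nzI.
have [m [c sys]] := residue_system_ideal (integral_ideal_OK K) idI nzI.
by rewrite (ideal_normE idI sys) card_ord; exists c.
Qed.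

Lemma ideal_norm_tower I J (T : finType) (d : T -> K) : integral_ideal I ->
  integral_ideal J -> nonzero_ideal I -> I `<=` J -> residue_system J I d ->
  ideal_norm I = (ideal_norm J * #|T|)%N.
Proof.
move=> idI idJ [x Ix x0] IJ sysd.
have [|c sysc] := ideal_norm_system idJ; first by exists x; [exact: IJ|].
have := residue_tower (ideal_subgroup (integral_ideal_OK K)) (ideal_subgroup idJ)
  (ideal_subgroup idI) IJ (fun y => @ideal_OK K J y idJ) sysc sysd.
by move/(ideal_normE idI) ->; rewrite card_prod card_ord.
Qed.

Lemma ideal_norm_gt0 I : integral_ideal I -> nonzero_ideal I -> (0 < ideal_norm I)%N.
Proof.
move=> idI nzI; have [c [_ cP]] := ideal_norm_system idI nzI.
by have [t _] := cP 0 (OK0 K); apply: leq_ltn_trans (ltn_ord t).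
Qed.

Lemma ideal_norm_OK : ideal_norm (OK K) = 1%N.
Proof.
rewrite (@ideal_normE _ _ unit (fun=> 0) (integral_ideal_OK K)) ?card_unit //.
split=> [_|y yO]; first exact: OK0.
by exists tt; split=> [|[]//]; rewrite subr0.
Qed.

Lemma ideal_norm_lt I J : integral_ideal I -> integral_ideal J ->
  nonzero_ideal I -> I `<=` J -> I <> J -> (ideal_norm J < ideal_norm I)%N.
Proof.
move=> idI idJ nzI IJ neIJ.
have [m [d sysd]] := residue_system_ideal idJ idI nzI.
have nzJ : nonzero_ideal J by case: nzI => x Ix x0; exists x => //; apply: IJ.
rewrite (ideal_norm_tower idI idJ nzI IJ sysd) card_ord.
rewrite ltn_Pmulr ?ideal_norm_gt0 // ltnNge; apply/negP => m1; apply: neIJ.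
apply/seteqP; split=> //.
by apply: (residue_trivial (ideal_subgroup idJ) (ideal_subgroup idI) sysd); rewrite card_ord.
Qed.

(** Multiplication by x preserves the index of I in J; the equality is cross-multiplied to stay in
    [nat]. With J = O_K it reads N(x I) = N((x)) N(I). *)
Lemma ideal_norm_dilate x I J : OK K x -> x != 0 ->
  integral_ideal I -> integral_ideal J -> nonzero_ideal I -> I `<=` J ->
  (ideal_norm (dilate x I) * ideal_norm J = ideal_norm (dilate x J) * ideal_norm I)%N.
Proof.
move=> xO x0 idI idJ nzI IJ; have [m [d sysd]] := residue_system_ideal idJ idI nzI.
have nzxI : nonzero_ideal (dilate x I).
  by case: nzI => y Iy y0; exists (x * y); [exists y | exact: mulf_neq0].
have xIJ : dilate x I `<=` dilate x J by move=> _ [y Iy <-]; exists y => //; apply: IJ.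
rewrite (ideal_norm_tower idI idJ nzI IJ sysd).
rewrite (@ideal_norm_tower (dilate x I) (dilate x J) _ ( *%R x \o d)) //.
- by rewrite -!mulnA (mulnC #|_|).
- exact: integral_ideal_dilate.
- exact: integral_ideal_dilate.
- apply: residue_image sysd => [|y z]; [exact: mulfI | exact: mulrBr].
Qed.

Lemma ideal_norm_conj I : integral_ideal I -> nonzero_ideal I ->
  ideal_norm (ideal_conj sigma I) = ideal_norm I.
Proof.
move=> idI nzI; have [c sysc] := ideal_norm_system idI nzI.
have imE A : conj @` A = ideal_conj sigma A.
  apply/seteqP; split=> [_ [y Ay <-]|y Ay]; first by rewrite /ideal_conj /= kconjK.
  by exists (conj y) => //; rewrite kconjK.
have := residue_image (inv_inj (kconjK sigma imagK)) (kconjB sigma imagK) sysc.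
rewrite !imE.
have -> : ideal_conj sigma (OK K) = OK K.
  apply/seteqP; split=> y; last exact: OK_conj.
  by rewrite -{2}(kconjK sigma imagK y); apply: OK_conj.
by move/ideal_normE ->; rewrite ?card_ord //; apply: integral_ideal_conj.
Qed.

(** Conjugate ideals have the same norm, so N((x))^2 = N((x conj x)) = N((n)) = n^2 for n =
    [knorm sigma x]. *)
Lemma ideal_norm_gen1 x : OK K x -> x != 0 ->
  ideal_norm (ideal_gen [set x]) = knorm sigma x.
Proof.
move=> xO x0; have xbarO := OK_conj sigma imagK xO.
have xbar0 : conj x != 0 by rewrite kconj_eq0.
have idx := integral_ideal_gen1 xO; have nzx := nonzero_gen1 x0.
have idy := integral_ideal_gen1 xbarO; have nzy := nonzero_gen1 xbar0.
have eqN : ideal_norm (ideal_gen [set conj x]) = ideal_norm (ideal_gen [set x]).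
  rewrite -(ideal_norm_conj idx nzx); congr ideal_norm; apply/seteqP; split.
    apply: gen1_subset; first exact: integral_ideal_conj.
    by rewrite /ideal_conj /= kconjK //; exact: mem_gen1.
  move=> y; rewrite /ideal_conj /= gen1E // => -[a aO aE].
  rewrite -(kconjK sigma imagK y) -aE kconjM // gen1E //.
  by exists (conj a) => //; exact: OK_conj.
have n_gt0 : (0 < knorm sigma x)%N.
  rewrite lt0n; apply: contraTneq (mulf_neq0 x0 xbar0) => n0.
  by rewrite (knormE sigma imagK xO) n0 eqxx.
apply/eqP; rewrite -eqn_sqr -mulnn -{2}eqN; apply/eqP.
have := ideal_norm_dilate xO x0 idy (integral_ideal_OK K) nzy (fun y => ideal_OK idy).
rewrite ideal_norm_OK muln1 -gen1E // -gen1_mul // gen1_mul_gen1 // => <-.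
rewrite (knormE sigma imagK xO); have [c sys] := residue_system_nat n_gt0.
rewrite (ideal_normE _ sys) ?card_prod ?card_ord //.
exact/integral_ideal_gen1/OK_nat.
Qed.

(** The ideal (2) lies strictly between 0 and O_K: an inverse of 2 in O_K would be fixed by
    conjugation, hence in Z. *)
Lemma maximal_nonzero P : maximal_ideal P -> nonzero_ideal P.
Proof.
case=> idP nP maxP; apply: contrapT => zP.
have P0 y : P y -> y = 0 by move=> Py; apply: contrapT => /eqP y0; apply: zP; exists y.
have two0 : 2%:R != 0 :> K by apply: (natr_neq0 sigma).
have id2 := integral_ideal_gen1 (OK_nat K 2).
case: (maxP _ id2) => [y /P0 ->|EP|EO]; first exact: ideal0.
  by move/eqP: two0; apply; apply: P0; rewrite -EP; apply: mem_gen1.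
have := OK1 K; rewrite -EO gen1E; last exact: OK_nat.
case=> a aO a2; have aE : a = 2%:R^-1 by apply: (mulfI two0); rewrite a2 divff.
have [||m mE] := @OK_fixed _ _ sigma imagK a => //.
  apply: (mulfI two0); rewrite a2 -{1}(kconj_nat sigma imagK 2) -kconjM // a2.
  exact: kconj1.
move: a2; rewrite mE -[2%:R]/((2:int)%:~R) -[1 in RHS]/((1:int)%:~R) -rmorphM /=.
by move/(@sigma_intr_inj _ _ sigma); lia.
Qed.

(** Among the proper ideals containing I, one of least norm is maximal, since a strictly larger
    ideal has a smaller norm. *)
Lemma maximal_ideal_exists I : integral_ideal I -> nonzero_ideal I ->
  I <> OK K -> exists2 P, maximal_ideal P & I `<=` P.
Proof.
move=> idI nzI neI.
have exN : exists n, `[< exists J, [/\ integral_ideal J, I `<=` J, J <> OK K & ideal_norm J = n] >].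
  by exists (ideal_norm I); apply/asboolP; exists I; split.
case: (ex_minnP exN) => n /asboolP[P [idP IP neP nP]] min_n.
exists P => //; split=> // J idJ PJ.
have [->|neJ] := pselect (J = OK K); [by right | left].
apply: contrapT => neJP; have nzP : nonzero_ideal P.
  by case: nzI => x Ix x0; exists x => //; apply: IP.
have := ideal_norm_lt idP idJ nzP PJ (nesym neJP); rewrite nP ltnNge.
by rewrite min_n //; apply/asboolP; exists J; split=> // x /IP/PJ.
Qed.

(* For [x] in I but not in I P, multiplication by [x] induces an isomorphism
   from O / P onto I / I P. *)
Lemma ideal_norm_mul_maximal I P : integral_ideal I -> nonzero_ideal I ->
  maximal_ideal P -> ideal_norm (ideal_mul I P) = (ideal_norm I * ideal_norm P)%N.
Proof.
move=> idI nzI maxP; have nzP := maximal_nonzero maxP.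
have [idP neP Pmax] := maxP.
have idIP := integral_ideal_mul idI idP; have nzIP := nonzero_mul nzI nzP.
have IPI := ideal_mul_subl idI idP.
have [x Ix nIPx] : exists2 x, I x & ~ ideal_mul I P x.
  apply: contrapT => nex; apply: neP; apply: (ideal_mul_injl sigma imagK idI) => //.
    exact: integral_ideal_OK.
  rewrite [RHS]ideal_mulC ideal_mul1 //; apply/seteqP; split=> // x Ix.
  by apply: contrapT => nIPx; apply: nex; exists x.
have xO := ideal_OK idI Ix.
have colonE u : OK K u -> ideal_mul I P (x * u) <-> P u.
  move=> uO; split=> [IPxu|Pu]; last exact: mem_ideal_mul.
  have idC := integral_ideal_colon xO idIP.
  case: (Pmax _ idC) => [v Pv|EP|EO].
  - by split; [exact: ideal_OK Pv | exact: mem_ideal_mul].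
  - by rewrite -EP.
  - by have := OK1 K; rewrite -EO => -[_]; rewrite mulr1.
have addE y : I y -> exists2 r, OK K r & ideal_mul I P (y - x * r).
  (* [S] is x O_K + I P. It lies between I P and I, so it is I L with L between P and O_K; L = P
     would put x in I P. *)
  pose S := [set y | I y /\ exists2 r, OK K r & ideal_mul I P (y - x * r)].
  have idS : integral_ideal S.
    split=> [z [] /(ideal_OK idI) //||z1 z2 [Iz1 [r1 r1O z1P]] [Iz2 [r2 r2O z2P]]|b z bO [Iz [r rO zP]]].
    - split; first exact: ideal0.
      by exists 0; [exact: OK0 | rewrite mulr0 subr0; exact: ideal0].
    - split; first exact: idealD.
      exists (r1 + r2); first exact: OK_D.
      have -> : z1 + z2 - x * (r1 + r2) = (z1 - x * r1) + (z2 - x * r2) by ring.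
      exact: (idealD idIP).
    - split; first exact: idealMl.
      exists (b * r); first exact: OK_M.
      have -> : b * z - x * (b * r) = b * (z - x * r) by ring.
      exact: (idealMl idIP).
  have [L idL SE] := ideal_dvd sigma imagK idI idS nzI (fun z Sz => proj1 Sz).
  have IPS : ideal_mul I P `<=` S.
    move=> z IPz; split; first exact: IPI.
    by exists 0; [exact: OK0 | rewrite mulr0 subr0].
  have PL : P `<=` L by apply: (ideal_mul_subsetl sigma imagK idI) => //; rewrite -SE.
  have Sx : S x by split=> //; exists 1; [exact: OK1 | rewrite mulr1 subrr; exact: ideal0].
  move: SE; case: (Pmax L idL PL) => -> SE; first by case: nIPx; rewrite -SE.
  by move: SE; rewrite ideal_mulC ideal_mul1 // => SE Iy; have [] : S y by rewrite SE.
have [c sysc] := ideal_norm_system idP nzP; have [cO cP] := sysc.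
rewrite (@ideal_norm_tower (ideal_mul I P) I _ ( *%R x \o c)) ?card_ord //.
split=> [t|y Iy] /=; first by rewrite mulrC; apply: idealMl.
have [r rO yr] := addE y Iy; have [t [Pt tU]] := cP r rO.
exists t; split=> [|s ys].
  rewrite -(subrKA (x * r)) -mulrBr; apply: (idealD idIP) => //.
  by apply/colonE => //; apply: OK_B.
apply: tU; apply/colonE; first exact: OK_B.
rewrite mulrBr -(subrKA y); apply: (idealD idIP) => //.
by rewrite -opprB; apply: (idealN idIP).
Qed.

(** Factorizations are lists with repetition, so that exponents are read off by [count_mem]. *)
Definition ideal_prod (s : seq (set K)) : set K := foldr (@ideal_mul K) (OK K) s.

Definition all_maximal (s : seq (set K)) : Prop := forall P, P \in s -> maximal_ideal P.

Lemma all_maximal_cons P s : all_maximal (P :: s) <-> maximal_ideal P /\ all_maximal s.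
Proof.
split=> [max_s|[maxP max_s] Q]; last by rewrite inE => /orP[/eqP ->|/max_s].
by split=> [|Q Qs]; apply: max_s; rewrite inE ?eqxx ?Qs ?orbT.
Qed.

Lemma all_maximal_cat s t : all_maximal s -> all_maximal t -> all_maximal (s ++ t).
Proof. by move=> max_s max_t P; rewrite mem_cat => /orP[/max_s|/max_t]. Qed.

Lemma ideal_prod_ideal s :
  all_maximal s -> integral_ideal (ideal_prod s) /\ nonzero_ideal (ideal_prod s).
Proof.
elim: s => [|P s IHs] /=; first by split; [exact: integral_ideal_OK | exact: nonzero_OK].
case/all_maximal_cons => maxP /IHs[ids nzs]; have nzP := maximal_nonzero maxP.
by split; [apply: integral_ideal_mul; case: maxP | exact: nonzero_mul].
Qed.

Lemma ideal_prod_cat s t : all_maximal s -> all_maximal t ->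
  ideal_prod (s ++ t) = ideal_mul (ideal_prod s) (ideal_prod t).
Proof.
move=> + max_t; elim: s => [|P s IHs] /=.
  by move=> _; rewrite ideal_mul1 //; case: (ideal_prod_ideal max_t).
case/all_maximal_cons => -[idP _ _] max_s; rewrite IHs // ideal_mulA //.
  by case: (ideal_prod_ideal max_s).
by case: (ideal_prod_ideal max_t).
Qed.

Lemma ideal_norm_mul_prod I s : integral_ideal I -> nonzero_ideal I ->
  all_maximal s ->
  ideal_norm (ideal_mul I (ideal_prod s)) = (ideal_norm I * \prod_(P <- s) ideal_norm P)%N.
Proof.
elim: s I => [|P s IHs] I idI nzI /=.
  by rewrite ideal_mulC ideal_mul1 // big_nil muln1.
case/all_maximal_cons => maxP max_s; have [idP _ _] := maxP.
have [ids nzs] := ideal_prod_ideal max_s; have nzP := maximal_nonzero maxP.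
rewrite ideal_mulA // IHs //; [|exact: integral_ideal_mul|exact: nonzero_mul].
by rewrite ideal_norm_mul_maximal // big_cons mulnA.
Qed.

(** Induction on the norm: a maximal ideal P containing I divides it, and the cofactor has smaller
    norm because N(P) > 1. *)
Lemma ideal_factorization I : integral_ideal I -> nonzero_ideal I ->
  exists2 s, all_maximal s & I = ideal_prod s.
Proof.
have [n] := ubnP (ideal_norm I); elim: n I => // n IHn I le_n idI nzI.
have [->|neI] := pselect (I = OK K); first by exists [::].
have [P maxP IP] := maximal_ideal_exists idI nzI neI.
have nzP := maximal_nonzero maxP; have [idP neP _] := maxP.
have [J idJ IE] := ideal_dvd sigma imagK idP idI nzP IP.
have nzJ : nonzero_ideal J by rewrite IE ideal_mulC in nzI; apply: nonzero_mul_l nzI.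
have [|s max_s JE] := IHn J _ idJ nzJ.
  rewrite -ltnS (leq_trans _ le_n) // ltnS IE ideal_mulC ideal_norm_mul_maximal //.
  rewrite ltn_Pmulr ?ideal_norm_gt0 // -ideal_norm_OK; apply: ideal_norm_lt => //.
  - exact: integral_ideal_OK.
  - by move=> x; apply: ideal_OK.
exists (P :: s); first exact/all_maximal_cons.
by rewrite IE JE.
Qed.

End IdealNorm.

(** * Places and the height *)

Section Places.
Variables (R : realType) (K : fieldExtType rat) (sigma : {rmorphism K -> R[i]}).
Hypothesis imagK : imaginary_quadratic R K.
Implicit Types (I J L P : set K) (x y z : K) (s t : seq (set K)).
Local Notation conj := (kconj sigma).

(** The colon ideal of P by x contains P, so it is P or all of O_K. *)
Lemma maximal_prime P x y : maximal_ideal P -> OK K x -> OK K y -> P (x * y) ->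
  P x \/ P y.
Proof.
case=> idP neP maxP xO yO Pxy; have idC := integral_ideal_colon xO idP.
case: (maxP _ idC) => [u Pu|EP|EO].
- by split; [exact: ideal_OK Pu | exact: idealMl].
- by right; rewrite -EP.
- by left; have := OK1 K; rewrite -EO => -[_]; rewrite mulr1.
Qed.

Lemma maximal_not1 P : maximal_ideal P -> ~ P 1.
Proof. by case=> idP neP _ P1; apply: neP; apply: ideal_with1. Qed.

Lemma maximal_prime_ideal P I J : maximal_ideal P ->
  integral_ideal I -> integral_ideal J -> ideal_mul I J `<=` P ->
  I `<=` P \/ J `<=` P.
Proof.
move=> maxP idI idJ IJP; have [IP|/existsNP[x /not_implyP[Ix nPx]]] := pselect (I `<=` P).
  by left.
right=> y Jy; have [|//|//] := maximal_prime maxP (ideal_OK idI Ix) (ideal_OK idJ Jy).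
by apply: IJP; apply: mem_ideal_mul.
Qed.

Lemma ideal_prod_not_subset P s : maximal_ideal P -> all_maximal s ->
  P \notin s -> ~ ideal_prod s `<=` P.
Proof.
move=> maxP; elim: s => [|Q s IHs] /=.
  by move=> _ _ /(_ 1 (OK1 K)); apply: maximal_not1.
case/all_maximal_cons => maxQ max_s; rewrite inE negb_or => /andP[neQ nPs].
have [idQ _ Qmax] := maxQ; have [ids _] := ideal_prod_ideal sigma imagK max_s.
case/maximal_prime_ideal => // [QP|]; last exact: IHs.
have [idP neP _] := maxP.
by have [EP|EP] := Qmax P idP QP; [rewrite EP eqxx in neQ | exact: neP].
Qed.

Lemma ideal_prod_subset P s : all_maximal s -> P \in s -> ideal_prod s `<=` P.
Proof.
elim: s => //= Q s IHs /all_maximal_cons[[idQ _ _] max_s].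
have [ids _] := ideal_prod_ideal sigma imagK max_s.
rewrite inE => /orP[/eqP ->|Ps]; first exact: ideal_mul_subl.
by rewrite ideal_mulC => x xs; apply: IHs => //; apply: (ideal_mul_subl ids idQ).
Qed.

(** * Multiplicities of maximal ideals and valuations *)

Lemma ideal_expE P n : ideal_exp P n = ideal_prod (nseq n P).
Proof. by elim: n => //= n <-. Qed.

Lemma all_maximal_nseq P n : maximal_ideal P -> all_maximal (nseq n P).
Proof. by move=> maxP Q; rewrite mem_nseq => /andP[_ /eqP ->]. Qed.

Lemma all_maximal_filter (p : pred (set K)) s :
  all_maximal s -> all_maximal (filter p s).
Proof. by move=> max_s Q; rewrite mem_filter => /andP[_ /max_s]. Qed.

Lemma ideal_prod_split P s : maximal_ideal P -> all_maximal s ->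
  ideal_prod s = ideal_mul (ideal_exp P (count_mem P s)) (ideal_prod (filter (predC1 P) s)).
Proof.
move=> maxP; have [idP _ _] := maxP.
elim: s => [|Q s IHs] /=; first by rewrite ideal_mul1 //; exact: integral_ideal_OK.
case/all_maximal_cons => maxQ max_s; have [idQ _ _] := maxQ.
have [idf _] := ideal_prod_ideal sigma imagK (@all_maximal_filter (predC1 P) _ max_s).
have [ide _] := ideal_prod_ideal sigma imagK (@all_maximal_nseq P (count_mem P s) maxP).
rewrite IHs // ideal_expE; case: (eqVneq Q P) => [->|neQ] /=.
  by rewrite add0n ideal_expE ideal_mulA.
by rewrite add0n ideal_expE ideal_mulCA.
Qed.

(** The part of unique factorization that valuations use. With c the multiplicity of P, a member of
    P^(c+1) would, after cancelling P^c, put the product of the other factors inside the prime P. *)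
Lemma ideal_expP P s a n : maximal_ideal P -> all_maximal s -> OK K a ->
  ideal_gen [set a] = ideal_prod s -> ideal_exp P n a <-> (n <= count_mem P s)%N.
Proof.
move=> maxP max_s aO aE; have max_n m := @all_maximal_nseq P m maxP.
have ide m : integral_ideal (ideal_exp P m) /\ nonzero_ideal (ideal_exp P m).
  by rewrite ideal_expE; apply: (ideal_prod_ideal sigma imagK).
have expD m k : ideal_exp P (m + k) = ideal_mul (ideal_exp P m) (ideal_exp P k).
  by rewrite !ideal_expE nseqD (ideal_prod_cat sigma imagK).
have max_f := @all_maximal_filter (predC1 P) _ max_s.
have [idf _] := ideal_prod_ideal sigma imagK max_f.
have aP : ideal_prod s a by rewrite -aE; apply: mem_gen1.
split=> [an|le_n]; last first.
  move: aP; rewrite (ideal_prod_split maxP max_s) -(subnKC le_n) expD.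
  move/(ideal_mul_subl (integral_ideal_mul (ide _).1 (ide _).1) idf).
  exact: (ideal_mul_subl (ide _).1 (ide _).1).
rewrite leqNgt; apply/negP => lt_n.
apply: (ideal_prod_not_subset maxP max_f); first by rewrite mem_filter /= eqxx.
set c := count_mem P s in lt_n *.
apply: (ideal_mul_subsetl sigma imagK (ide c).1 idf _ (ide c).2); first by case: maxP.
have -> : ideal_mul (ideal_exp P c) P = ideal_exp P (c + 1).
  by rewrite expD {3}/ideal_exp /= (ideal_mulC P) ideal_mul1 //; case: maxP.
rewrite -(ideal_prod_split maxP max_s) -aE.
apply: gen1_subset; first exact: (ide _).1.
move: an; rewrite -(subnKC lt_n) expD -/c addn1.
exact: (ideal_mul_subl (ide _).1 (ide _).1).
Qed.

Lemma ord_intE P s a : maximal_ideal P -> all_maximal s -> OK K a ->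
  ideal_gen [set a] = ideal_prod s -> ord_int P a = count_mem P s.
Proof.
move=> maxP max_s aO aE; have expP n : ideal_exp P n a <-> (n <= count_mem P s)%N by apply: ideal_expP.
have [] : ideal_exp P (ord_int P a) a /\ ~ ideal_exp P (ord_int P a).+1 a.
  apply: (@getPex _ [set n | ideal_exp P n a /\ ~ ideal_exp P n.+1 a]).
  by exists (count_mem P s); split; [apply/expP | move/expP; rewrite ltnn].
move=> /expP le_o nle_o; apply/eqP; rewrite eqn_leq le_o leqNgt.
by apply/negP => lt_o; apply: nle_o; apply/expP.
Qed.

Lemma ideal_gen1_factorization a : OK K a -> a != 0 ->
  exists2 s, all_maximal s & ideal_gen [set a] = ideal_prod s.
Proof.
move=> aO a0; apply: (ideal_factorization sigma imagK).
  exact: integral_ideal_gen1.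
exact: nonzero_gen1.
Qed.

Lemma ord_intM P a b : maximal_ideal P -> OK K a -> OK K b -> a != 0 -> b != 0 ->
  ord_int P (a * b) = (ord_int P a + ord_int P b)%N.
Proof.
move=> maxP aO bO a0 b0.
have [s max_s aE] := ideal_gen1_factorization aO a0.
have [t max_t bE] := ideal_gen1_factorization bO b0.
rewrite (ord_intE maxP max_s aO aE) (ord_intE maxP max_t bO bE) -count_cat.
apply: ord_intE => //; [exact: all_maximal_cat | exact: OK_M |].
by rewrite (ideal_prod_cat sigma imagK) // -aE -bE gen1_mul_gen1.
Qed.

(** [valuation] picks some fraction representing its argument; additivity of [ord_int] makes the
    difference of orders independent of that choice. *)
Lemma valuationE P a b : maximal_ideal P -> OK K a -> OK K b -> a != 0 -> b != 0 ->
  valuation P (a / b) = (ord_int P a)%:Z - (ord_int P b)%:Z.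
Proof.
move=> maxP aO bO a0 b0; have : exists n : int, exists a' b', [/\ OK K a', OK K b', a' != 0, b' != 0 &
    a / b = a' / b' /\ n = (ord_int P a')%:Z - (ord_int P b')%:Z].
  by exists ((ord_int P a)%:Z - (ord_int P b)%:Z), a, b.
move/(xgetPex 0); rewrite -/(valuation P (a / b)) => -[a' [b' [a'O b'O a'0 b'0 [abE ->]]]].
have : ord_int P (a * b') = ord_int P (a' * b).
  congr ord_int; apply: (mulIf (invr_neq0 b0)).
  by rewrite mulrAC abE mulfK // divfK.
by rewrite !ord_intM //; lia.
Qed.

(** * Residue characteristic, ramification index and inertia degree *)

(** Let n be the least positive integer in P and p its smallest prime factor. As P is prime, it
    contains p or n / p, and n / p is excluded by minimality. *)
Lemma residue_charP P : maximal_ideal P -> prime (residue_char P) /\ P (residue_char P)%:R.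
Proof.
move=> maxP; have [idP _ _] := maxP.
apply: (@getPex _ [set p | prime p /\ P p%:R]).
have exn : exists n, `[< (0 < n)%N /\ P n%:R >].
  have [n n_gt0 Pn] := ideal_int sigma imagK idP (maximal_nonzero sigma imagK maxP).
  by exists n; apply/asboolP.
case: (ex_minnP exn) => n /asboolP[n_gt0 Pn] min_n.
have n_gt1 : (1 < n)%N.
  by case: n n_gt0 Pn {min_n} => [//|[|//]] _ /(maximal_not1 maxP).
exists (pdiv n); split; first exact: pdiv_prime.
have [m nE] := dvdnP (pdiv_dvd n).
move: Pn; rewrite {1}nE natrM => /(maximal_prime maxP (OK_nat K m) (OK_nat K _))[Pm|//].
have m_gt0 : (0 < m)%N by move: n_gt0; rewrite nE muln_gt0 => /andP[].
have : (n <= m)%N by apply: min_n; apply/asboolP; split.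
by rewrite leqNgt {1}nE ltn_Pmulr ?prime_gt1 ?pdiv_prime.
Qed.

Lemma ramification_index_gt0 P : maximal_ideal P -> (0 < ramification_index P)%N.
Proof.
move=> maxP; have [p_prime Pp] := residue_charP maxP; have [idP _ _] := maxP.
have pO := OK_nat K (residue_char P).
have [||s max_s pE] := @ideal_gen1_factorization (residue_char P)%:R => //.
  exact/(natr_neq0 sigma)/prime_gt0.
rewrite /ramification_index (ord_intE maxP max_s pO pE).
apply/(@ideal_expP P s _ 1 maxP max_s pO pE).
by rewrite /ideal_exp /= ideal_mulC ideal_mul1.
Qed.

(* A spanning family of minimal size is a basis: in a nontrivial relation some
   coefficient is invertible modulo the residue characteristic. *)
Lemma inertia_degree_gt0 P : maximal_ideal P -> (0 < inertia_degree P)%N.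
Proof.
move=> maxP; have [idP _ _] := maxP; have [p_prime Pp] := residue_charP maxP.
set p := residue_char P in p_prime Pp.
pose span d (b : 'I_d -> K) := (forall i, OK K (b i)) /\
  forall y, OK K y -> exists c : 'I_d -> int, P (y - \sum_(i < d) (c i)%:~R * b i).
have exd : exists d, `[< exists b : 'I_d -> K, span d b >].
  have [w [wO w_span _]] := OK_basis sigma imagK.
  exists 2%N; apply/asboolP; exists (fun i => if i == ord0 then 1 else w).
  split=> [i|y yO]; first by case: ifP => // _; exact: OK1.
  have [m [n ->]] := w_span y yO; exists (fun i => if i == ord0 then m else n).
  by rewrite !big_ord_recl big_ord0 /= addr0 mulr1 subrr; apply: ideal0.
case: (ex_minnP exd) => d /asboolP[b [bO b_span]] min_d.
have : exists b : 'I_(inertia_degree P) -> K, residue_basis P b.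
  apply: (@getPex _ [set d | exists b : 'I_d -> K, residue_basis P b]).
  exists d, b; split=> // c Pc i; apply: contrapT => /negP ndvd.
  case: d i b c bO b_span min_d Pc ndvd => [[]//|d] i b c bO b_span min_d Pc ndvd.
  suff : (d.+1 <= d)%N by rewrite ltnn.
  have [u [v uvE]] : exists u v : int, 1 = u * c i + v * p%:Z.
    have cop : coprimez (c i) p.
      rewrite /coprimez /gcdz -[_ == _]/(coprime `|c i| p) coprime_sym.
      by rewrite prime_coprime.
    by have [[u v] /= uvE] := coprimezP _ _ cop; exists u, v.
  apply: min_d; apply/asboolP; exists (fun j => b (lift i j)); split=> // y yO.
  have [c' Pc'] := b_span y yO.
  exists (fun j => c' (lift i j) - c' i * u * c (lift i j)).
  move: Pc Pc'; rewrite (bigD1_ord i) //= [X in y - X](bigD1_ord i) //=.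
  set S1 := \sum_(j < d) _; set S2 := \sum_(j < d) _ => Pc Pc'.
  have -> : y - \sum_(j < d) (c' (lift i j) - c' i * u * c (lift i j))%:~R * b (lift i j)
      = (y - ((c' i)%:~R * b i + S2)) + (c' i * u)%:~R * ((c i)%:~R * b i + S1)
        + ((c' i * v)%:~R * b i) * p%:R.
    have -> : \sum_(j < d) (c' (lift i j) - c' i * u * c (lift i j))%:~R * b (lift i j)
        = S2 - (c' i * u)%:~R * S1.
      rewrite /S1 /S2 mulr_sumr -sumrB; apply: eq_bigr => j _.
      by rewrite !(rmorphB, rmorphM) /=; ring.
    have -> : (c' i)%:~R * b i = (c' i)%:~R * (u * c i + v * p%:Z)%:~R * b i.
      by rewrite -uvE mulr1.
    by rewrite !(rmorphD, rmorphM) /= -pmulrn; ring.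
  apply: (idealD idP).
    by apply: (idealD idP) => //; apply: (idealMl idP) => //; exact: OK_int.
  by apply: (idealMl idP) => //; apply: OK_M; [exact: OK_int | exact: bO].
case: (inertia_degree P) => // -[b0 [_ b0_span _]].
have [c] := b0_span 1 (OK1 K); rewrite big_ord0 subr0.
by move/(maximal_not1 maxP).
Qed.

(** * Local factors and the height of a fraction *)

Lemma place_absE P x : maximal_ideal P -> x != 0 ->
  place_abs sigma (Some P) x ^+ local_degree (Some P) =
  (ideal_norm P)%:R `^ (- (valuation P x)%:~R).
Proof.
move=> maxP x0; rewrite /= (negPf x0) -powR_mulrn ?powR_ge0 // -powRrM.
by rewrite divfK // pnatr_eq0 -lt0n muln_gt0 ramification_index_gt0 // inertia_degree_gt0.
Qed.

Lemma knorm_normc x : OK K x -> Normc.normc (sigma x) ^+ 2 = (knorm sigma x)%:R.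
Proof.
move=> xO; apply: (@complexI R).
by rewrite -sigma_norm // (knormE sigma imagK) // !rmorph_nat.
Qed.

Lemma knorm_gt0 x : OK K x -> x != 0 -> (0 < knorm sigma x)%N.
Proof.
move=> xO x0; rewrite lt0n; apply/eqP => n0.
have := knormE sigma imagK xO; rewrite n0 => /eqP.
by rewrite mulf_eq0 kconj_eq0 // orbb (negPf x0).
Qed.

Lemma height_fraction x y : OK K x -> OK K y -> x != 0 -> y != 0 ->
  height sigma (x / y) =
  Num.max (knorm sigma x)%:R (knorm sigma y)%:R / (ideal_norm (ideal_gen [set x; y]))%:R.
Proof.
move=> xO yO x0 y0; set I := ideal_gen [set x; y].
have idI : integral_ideal I by apply: integral_ideal_gen2.
have nzI : nonzero_ideal I by exists x => //; apply: mem_gen2l.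
have factor z : OK K z -> z != 0 -> I z -> exists2 s, all_maximal s &
    ideal_gen [set z] = ideal_mul I (ideal_prod s).
  move=> zO z0 Iz; have idz := integral_ideal_gen1 zO; have nzz := nonzero_gen1 z0.
  have [J idJ zE] := ideal_dvd sigma imagK idI idz nzI (gen1_subset idI Iz).
  have nzJ : nonzero_ideal J by rewrite zE ideal_mulC in nzz; apply: nonzero_mul_l nzz.
  have [s max_s JE] := ideal_factorization sigma imagK idJ nzJ.
  by exists s => //; rewrite zE JE.
have [sx max_x xE] := factor x xO x0 (@mem_gen2l K x y).
have [sy max_y yE] := factor y yO y0 (@mem_gen2r K x y).
have [sI max_I IE] := ideal_factorization sigma imagK idI nzI.
have [idx _] := ideal_prod_ideal sigma imagK max_x.
have [idy _] := ideal_prod_ideal sigma imagK max_y.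
(* If P divided both cofactors, x and y, hence all of I, would lie in I P; cancelling I would leave
   O_K inside P. *)
have disj P : P \in sx -> P \in sy -> False.
  move=> Px Py; have maxP := max_x _ Px; have [idP _ _] := maxP.
  apply: (maximal_not1 maxP).
  suff : OK K `<=` P by apply; exact: OK1.
  apply: (ideal_mul_subsetl sigma imagK idI (integral_ideal_OK K) idP nzI).
  rewrite ideal_mulC ideal_mul1 //; apply: gen2_subset; first exact: integral_ideal_mul.
    have : ideal_gen [set x] x by exact: mem_gen1.
    by rewrite xE; apply: ideal_mulS => //; apply: ideal_prod_subset.
  have : ideal_gen [set y] y by exact: mem_gen1.
  by rewrite yE; apply: ideal_mulS => //; apply: ideal_prod_subset.
have valE P : maximal_ideal P ->
    valuation P (x / y) = (count_mem P sx)%:Z - (count_mem P sy)%:Z.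
  move=> maxP; rewrite valuationE //.
  rewrite (@ord_intE P (sI ++ sx) x) //; [|exact: all_maximal_cat|]; last first.
    by rewrite (ideal_prod_cat sigma imagK) // -IE.
  rewrite (@ord_intE P (sI ++ sy) y) //; [|exact: all_maximal_cat|]; last first.
    by rewrite (ideal_prod_cat sigma imagK) // -IE.
  by rewrite !count_cat; lia.
pose f (v : option (set K)) : R := Num.max (place_abs sigma v (x / y) ^+ local_degree v) 1.
have xy0 : x / y != 0 by rewrite mulf_neq0 ?invr_neq0.
have fP P : maximal_ideal P -> f (Some P) = (ideal_norm P)%:R ^+ count_mem P sy.
  move=> maxP; rewrite /f place_absE // valE //.
  have [idP _ _] := maxP; have nzP := maximal_nonzero sigma imagK maxP.
  have NP1 : 1 <= (ideal_norm P)%:R :> R by rewrite ler1n (ideal_norm_gt0 sigma imagK).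
  have [Py|nPy] := boolP (P \in sy).
    have -> : count_mem P sx = 0%N by apply/count_memPn/negP => /disj; apply.
    rewrite sub0r rmorphN opprK powR_mulrn ?ler0n //.
    by apply/max_idPl; apply: exprn_ege1.
  rewrite (count_memPn nPy) subr0 expr0; apply/max_idPr.
  by rewrite -[leRHS](powRr0 (ideal_norm P)%:R); apply: ler_powR => //; rewrite oppr_le0 ler0n.
have fN : f None = Num.max ((knorm sigma x)%:R / (knorm sigma y)%:R) 1.
  rewrite /f /= fmorph_div /= Normc.normcM Normc.normcV exprMn exprVn.
  by rewrite !knorm_normc.
(* The places whose factor can differ from 1. Each occurs once, hence [undup]; its multiplicity in
   [sy] is the exponent of its local factor. *)
pose r := None :: map Some (undup sy).
have r_uniq : uniq r.
  rewrite /= map_inj_uniq ?undup_uniq ?andbT; last by move=> ? ? [].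
  by apply/negP => /mapP[].
have heightE : height sigma (x / y) = \prod_(v <- r) f v.
  rewrite (fsbig_seq _ _ r_uniq) /height; apply/esym/fsbig_widen.
    case=> [P|//] /=; rewrite inE => /mapP[Q]; rewrite mem_undup => /max_y maxQ [->].
    exact: maxQ.
  move=> [P|] [] /=; last by rewrite inE.
  move=> maxP nP; rewrite -/(f (Some P)) fP // (count_memPn _) ?expr0 //.
  apply/negP => Py; apply: nP; rewrite inE; apply/mapP.
  by exists P; rewrite ?mem_undup.
have prodE : \prod_(v <- r) f v = f None * (\prod_(P <- sy) ideal_norm P)%:R.
  rewrite /r big_cons big_map; congr (_ * _).
  rewrite natr_prod -[RHS]prodr_undup_exp_count big_seq [RHS]big_seq.
  by apply: eq_bigr => P; rewrite mem_undup => /max_y /fP.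
have normE : (knorm sigma y)%:R = (ideal_norm I)%:R * (\prod_(P <- sy) ideal_norm P)%:R :> R.
  by rewrite -natrM -(ideal_norm_gen1 sigma imagK) // yE (ideal_norm_mul_prod sigma imagK).
have NI0 : (ideal_norm I)%:R != 0 :> R.
  by rewrite pnatr_eq0 -lt0n (ideal_norm_gt0 sigma imagK).
have Ny0 : (knorm sigma y)%:R != 0 :> R by rewrite pnatr_eq0 -lt0n knorm_gt0.
have prodE2 : (\prod_(P <- sy) ideal_norm P)%:R = (knorm sigma y)%:R / (ideal_norm I)%:R :> R.
  by rewrite normE mulrAC divff // mul1r.
rewrite heightE prodE prodE2 fN mulrA; congr (_ / _).
by rewrite maxr_pMl ?ler0n // divfK // mul1r.
Qed.

End Places.

(** * Units and packets *)

Section HeightBound.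
Variables (R : realType) (K : fieldExtType rat) (sigma : {rmorphism K -> R[i]}).
Hypothesis imagK : imaginary_quadratic R K.
Implicit Types (I J : set K) (u x y z : K).

Lemma knormM x y : OK K x -> OK K y ->
  knorm sigma (x * y) = (knorm sigma x * knorm sigma y)%N.
Proof.
move=> xO yO; have E : (knorm sigma (x * y))%:R = (knorm sigma x * knorm sigma y)%:R :> K.
  rewrite natrM -!(knormE sigma imagK) //; last exact: OK_M.
  by rewrite kconjM //; ring.
by have [] : Posz (knorm sigma (x * y)) = Posz (knorm sigma x * knorm sigma y)
  by apply: (@sigma_intr_inj _ _ sigma).
Qed.

Lemma knorm1 : knorm sigma 1 = 1%N.
Proof.
have := knormE sigma imagK (OK1 K); rewrite kconj1 // mulr1 => E.
by have [] : Posz 1 = Posz (knorm sigma 1) by apply: (@sigma_intr_inj _ _ sigma).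
Qed.

(* The trace of [u] is an integer of absolute value at most 2, and
   [u ^+ 12 = 1] in each of the five cases. *)
Lemma unit_root_of_unity u : OK K u -> knorm sigma u = 1%N -> roots_of_unity K u.
Proof.
move=> uO u1; have uu : u * kconj sigma u = 1 by rewrite (knormE sigma imagK) // u1.
have [||t tE] := @OK_fixed _ _ sigma imagK (u + kconj sigma u).
- by apply: OK_D => //; apply: OK_conj.
- by rewrite kconjD // kconjK // addrC.
have tle : t ^+ 2 <= 4.
  rewrite -(ler_int R).
  have uR : (complex.Re (sigma u)) ^+ 2 + (complex.Im (sigma u)) ^+ 2 = 1.
    have := congr1 sigma uu; rewrite rmorphM rmorph1 sigma_conj //.
    case: (sigma u) => p q /= /(congr1 (@complex.Re R)) /= <-; ring.
  have tR : t%:~R = 2 * complex.Re (sigma u).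
    have := congr1 sigma tE; rewrite rmorphD sigma_conj // rmorph_int.
    rewrite -(rmorph_int (real_complex R)).
    case: (sigma u) => p q /= /(congr1 (@complex.Re R)) /= <-; ring.
  rewrite rmorphXn /= tR -[4%:~R]/(4 : R).
  have := sqr_ge0 (complex.Im (sigma u)); move: uR.
  set p := complex.Re _; set q := complex.Im _; nra.
have u2 : u ^+ 2 = t%:~R * u - 1 by rewrite -tE -uu; ring.
(* For t = 2, -2, -1, 0, 1 the order of u is 1, 2, 3, 4, 6, and 12 is the least common multiple. *)
exists 12%N => //; apply/unity_rootP.
have : [|| t == -2, t == -1, t == 0, t == 1 | t == 2] by nia.
have u3 : u ^+ 3 = (t%:~R ^+ 2 - 1) * u - t%:~R.
  transitivity (u * u ^+ 2); first by ring.
  rewrite u2; transitivity (t%:~R * u ^+ 2 - u); first by ring.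
  by rewrite u2; ring.
case/or4P=> [/eqP tv|/eqP tv|/eqP tv|/orP[] /eqP tv]; rewrite tv in u2 u3.
- have /eqP : (u + 1) ^+ 2 = 0 by transitivity (u ^+ 2 + 2 * u + 1); [|rewrite u2]; ring.
  by rewrite sqrf_eq0 addr_eq0 => /eqP ->; ring.
- by transitivity ((u ^+ 3) ^+ 4); [|rewrite u3]; ring.
- by transitivity ((u ^+ 2) ^+ 6); [|rewrite u2]; ring.
- by transitivity ((u ^+ 3) ^+ 4); [|rewrite u3]; ring.
- have /eqP : (u - 1) ^+ 2 = 0 by transitivity (u ^+ 2 - 2 * u + 1); [|rewrite u2]; ring.
  by rewrite sqrf_eq0 subr_eq0 => /eqP ->; ring.
Qed.

(** The norm is multiplicative with natural values, and a natural number with a positive power equal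
    to 1 is 1. *)
Lemma root_of_unity_OK z : roots_of_unity K z ->
  [/\ OK K z, knorm sigma z = 1%N & z != 0].
Proof.
case=> n n_gt0 /unity_rootP zn.
have zO : OK K z.
  exists ('X^n - 1); first exact: monicXnsubC.
  by rewrite /root rmorphB rmorph1 rmorphXn /= map_polyX !hornerE zn subrr.
split=> //; last by apply: contra_eq_neq zn => ->; rewrite expr0n eqn0Ngt n_gt0 /= mulr0n eq_sym oner_neq0.
have : (knorm sigma z ^ n)%N = 1%N.
  have E m : knorm sigma (z ^+ m) = (knorm sigma z ^ m)%N /\ OK K (z ^+ m).
    elim: m => [|m [IHm zmO]]; first by rewrite expr0 knorm1; split=> //; exact: OK1.
    by rewrite exprS knormM // IHm expnS; split=> //; exact: OK_M.
  by rewrite -(E n).1 zn knorm1.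
by move=> nm1; apply/eqP; rewrite -(eqn_exp2r _ _ n_gt0) exp1n nm1.
Qed.

Lemma roots_of_unity_div z w : roots_of_unity K z -> roots_of_unity K w ->
  roots_of_unity K (z / w).
Proof.
case=> n n_gt0 /unity_rootP zn [m m_gt0 /unity_rootP wm].
exists (n * m)%N; first by rewrite muln_gt0 n_gt0.
apply/unity_rootP.
by rewrite exprMn exprVn exprM zn expr1n mulnC exprM wm expr1n invr1 mulr1.
Qed.

(** * Generators up to roots of unity and class representatives *)

Lemma gen1_eq_root_of_unity x y : OK K x -> OK K y -> x != 0 ->
  ideal_gen [set x] = ideal_gen [set y] ->
  exists2 z, roots_of_unity K z & x = z * y.
Proof.
move=> xO yO x0 xy.
have [a aO ax] : dilate y (OK K) x by rewrite -gen1E // -xy; exact: mem_gen1.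
have [b bO yb] : dilate x (OK K) y by rewrite -gen1E // xy; exact: mem_gen1.
have ab : a * b = 1 by apply: (mulfI x0); rewrite (mulrC a) mulrA yb ax mulr1.
exists a; last by rewrite mulrC ax.
apply: unit_root_of_unity => //; apply/eqP.
by have := knormM aO bO; rewrite ab knorm1 => /esym/eqP; rewrite muln_eq1 => /andP[].
Qed.

Lemma gen1_mul_root_of_unity z x : roots_of_unity K z -> OK K x ->
  ideal_gen [set z * x] = ideal_gen [set x].
Proof.
move=> zU xO; have [zO _ z0] := root_of_unity_OK zU.
have [z'O _ _] : [/\ OK K z^-1, knorm sigma z^-1 = 1%N & z^-1 != 0].
  apply: root_of_unity_OK; rewrite -div1r; apply: roots_of_unity_div => //.
  by exists 1%N => //; apply/unity_rootP; rewrite expr1n.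
apply/seteqP; split; apply: gen1_subset.
- exact: integral_ideal_gen1.
- by rewrite gen1E //; exists z => //; rewrite mulrC.
- exact/integral_ideal_gen1/OK_M.
- rewrite gen1E; last exact: OK_M.
  by exists z^-1 => //; rewrite mulrAC divff ?mul1r.
Qed.

(** Numerator and denominator can thus be replaced by listed generators, independently, while (x, y)
    stays equal to the representative. *)
Lemma gen2_congr x y x' y' : OK K x -> OK K y -> OK K x' -> OK K y' ->
  ideal_gen [set x] = ideal_gen [set x'] -> ideal_gen [set y] = ideal_gen [set y'] ->
  ideal_gen [set x; y] = ideal_gen [set x'; y'].
Proof.
have half a b a' b' : OK K a' -> OK K b' ->
    ideal_gen [set a] = ideal_gen [set a'] -> ideal_gen [set b] = ideal_gen [set b'] ->
    ideal_gen [set a; b] `<=` ideal_gen [set a'; b'].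
  move=> a'O b'O aE bE; have idg := integral_ideal_gen2 a'O b'O.
  apply: gen2_subset => //.
    apply: (gen1_subset idg (@mem_gen2l K a' b')); rewrite -aE; exact: mem_gen1.
  apply: (gen1_subset idg (@mem_gen2r K a' b')); rewrite -bE; exact: mem_gen1.
by move=> xO yO x'O y'O xE yE; apply/seteqP; split; apply: half.
Qed.

Lemma fractional_gen2 x y : OK K x -> OK K y -> x != 0 ->
  fractional_ideal (ideal_gen [set x; y]).
Proof.
move=> xO yO x0; have idI := integral_ideal_gen2 xO yO; split.
- exact: ideal0.
- by exists x => //; apply: mem_gen2l.
- by move=> ? ?; apply: idealD.
- by move=> ? ?; apply: idealMl.
exists 1; split; [exact: OK1 | exact: oner_neq0 |].
by move=> _ [z Iz <-]; rewrite mul1r; apply: ideal_OK Iz.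
Qed.

(** Write gamma = x / y. The class of (x, y) is that of some a_l, so (x, y) = alpha a_l; dividing x
    and y by alpha keeps the fraction and turns the ideal into a_l. *)
Lemma fraction_representative (h : nat) (a : 'I_h -> set K) (gamma : K) :
  class_representatives a -> gamma != 0 ->
  exists l x y, [/\ OK K x, OK K y, x != 0, y != 0 &
    gamma = x / y /\ ideal_gen [set x; y] = a l].
Proof.
move=> [ida [_ _ a_surj]] g0; have [x [y [xO yO y0 gE]]] := OK_fraction sigma imagK gamma.
have x0 : x != 0 by apply: contra_neq g0 => x0; rewrite gE x0 mul0r.
have fracI := fractional_gen2 xO yO x0; have idI := integral_ideal_gen2 xO yO.
set I := ideal_gen [set x; y] in fracI idI.
have [l _ lE] : [set ideal_class (a l) | l in [set: 'I_h]] (ideal_class I).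
  by apply: a_surj; exists I.
have : ideal_class I I.
  split=> //; exists 1; first exact: oner_neq0.
  apply/seteqP; split=> [z Iz|_ [z Iz <-]]; last by rewrite mul1r.
  by exists z; rewrite ?mul1r.
rewrite -lE => -[_ [alpha alpha0 IE]].
have mem z : I (alpha * z) <-> a l z.
  rewrite IE; split=> [[w aw /(mulfI alpha0) <-] //|az]; by exists z.
have ax : a l (x / alpha) by apply/mem; rewrite mulrC divfK //; apply: mem_gen2l.
have ay : a l (y / alpha) by apply/mem; rewrite mulrC divfK //; apply: mem_gen2r.
exists l, (x / alpha), (y / alpha); split.
- exact: ideal_OK ax.
- exact: ideal_OK ay.
- by rewrite mulf_neq0 ?invr_neq0.
- by rewrite mulf_neq0 ?invr_neq0.
split; first by rewrite gE; field; rewrite y0 alpha0.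
have idJ := integral_ideal_gen2 (ideal_OK (ida l) ax) (ideal_OK (ida l) ay).
apply/seteqP; split; first exact: gen2_subset.
move=> z /mem Iz.
(* [S] is the integral part of alpha (x / alpha, y / alpha). It is an ideal containing x and y,
   hence all of I. *)
pose S := [set w | OK K w /\ ideal_gen [set x / alpha; y / alpha] (w / alpha)].
have idS : integral_ideal S.
  split=> [w [] //||v w [vO Jv] [wO Jw]|b w bO [wO Jw]].
  - by split; [exact: OK0 | rewrite mul0r; apply: ideal0].
  - by split; [exact: OK_D | rewrite mulrDl; apply: (idealD idJ)].
  - by split; [exact: OK_M | rewrite -mulrA; apply: (idealMl idJ)].
have /(_ _ Iz)[_] : I `<=` S.
  apply: gen2_subset => //; split=> //; [exact: mem_gen2l | exact: mem_gen2r].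
by rewrite mulrAC divff ?mul1r.
Qed.

Lemma height_fraction_le (B : R) x y : OK K x -> OK K y -> x != 0 -> y != 0 ->
  height sigma (x / y) <= B <->
  [/\ (knorm sigma x)%:R <= B * (ideal_norm (ideal_gen [set x; y]))%:R &
      (knorm sigma y)%:R <= B * (ideal_norm (ideal_gen [set x; y]))%:R].
Proof.
move=> xO yO x0 y0; rewrite (height_fraction sigma imagK) // ler_pdivrMr.
  by rewrite ge_max; split=> [/andP[]|[-> ->]].
rewrite ltr0n (ideal_norm_gt0 sigma imagK) //; first exact: integral_ideal_gen2.
by exists x => //; apply: mem_gen2l.
Qed.

End HeightBound.

Theorem theorem4p7 (R : realType) (K : fieldExtType rat)
    (sigma : {rmorphism K -> R[i]}) (B : R)
    (h : nat) (a : 'I_h -> set K)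
    (s : 'I_h -> nat) (g : forall l : 'I_h, 'I_(s l) -> K) :
  imaginary_quadratic R K ->
  1 <= B ->
  class_representatives a ->
  (forall l, lists_generators B (a l) (@g l)) ->
  [set gamma : K | gamma != 0 /\ height sigma gamma <= B] =
  roots_of_unity K `|` \bigcup_(p in packets a g) packet_F g p.
Proof.
move=> imagK B1 reps gens; have [ida _] := reps.
have genO l i : OK K (g l i) := (gens l).1 i.
have gen_bound l i : [/\ OK K (g l i), g l i != 0 &
    (knorm sigma (g l i))%:R <= B * (ideal_norm (a l))%:R].
  have gO := genO l i; have [gfun _ _] := (gens l).2.
  have [_ nz _ le_norm] := gfun i I.
  have g0 : g l i != 0.
    apply/eqP => g0; apply: nz; rewrite g0; apply/seteqP; split=> [z|_ ->].
      by rewrite gen1E ?g0; [case=> w _ <-; rewrite mul0r | exact: OK0].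
    exact: mem_gen1.
  by split=> //; rewrite -(ideal_norm_gen1 sigma imagK).
have gen_ex l x : a l x -> x != 0 -> (knorm sigma x)%:R <= B * (ideal_norm (a l))%:R ->
    exists i : 'I_(s l), ideal_gen [set g l i] = ideal_gen [set x].
  move=> ax x0 le_x; have xO := ideal_OK (ida l) ax; have [_ _ gsurj] := (gens l).2.
  have [|i _ iE] := gsurj (ideal_gen [set x]); last by exists i.
  split; first by exists x.
  - by move=> E; move/eqP: x0; apply; have := @mem_gen1 K x; rewrite E.
  - exact: gen1_subset.
  - by rewrite (ideal_norm_gen1 sigma imagK).
have height_le l (i j : 'I_(s l)) z : roots_of_unity K z ->
    ideal_gen [set g l i; g l j] = a l -> height sigma (z * g l i / g l j) <= B.
  move=> zU ijE; have [zO z1 z0] := root_of_unity_OK sigma imagK zU.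
  have [giO gi0 le_i] := gen_bound l i; have [gjO gj0 le_j] := gen_bound l j.
  have zgO : OK K (z * g l i) by apply: OK_M.
  apply/(height_fraction_le sigma imagK B zgO gjO (mulf_neq0 z0 gi0) gj0).
  rewrite (gen2_congr zgO gjO giO gjO (gen1_mul_root_of_unity sigma imagK zU giO) erefl).
  by rewrite ijE (knormM sigma imagK) // z1 mul1n.
apply/seteqP; split=> [gamma [gamma0 le_gamma]|gamma].
  have [l [x [y [xO yO x0 y0 [gE xyE]]]]] := fraction_representative sigma imagK reps gamma0.
  move: le_gamma; rewrite gE => /(height_fraction_le sigma imagK B xO yO x0 y0).
  rewrite xyE => -[le_x le_y].
  have ax : a l x by rewrite -xyE; exact: mem_gen2l.
  have ay : a l y by rewrite -xyE; exact: mem_gen2r.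
  have [i iE] := gen_ex l x ax x0 le_x; have [j jE] := gen_ex l y ay y0 le_y.
  have [u uU xE] := gen1_eq_root_of_unity sigma imagK xO (genO l i) x0 (esym iE).
  have [v vU yE] := gen1_eq_root_of_unity sigma imagK yO (genO l j) y0 (esym jE).
  have uvU := roots_of_unity_div uU vU.
  have [_ gi0 _] := gen_bound l i; have [_ gj0 _] := gen_bound l j.
  have [_ _ v0] := root_of_unity_OK sigma imagK vU.
  have xy : x / y = (u / v) * (g l i / g l j) by rewrite xE yE mulf_div.
  have ijE : ideal_gen [set g l i; g l j] = a l by rewrite -xyE; apply: gen2_congr.
  (* The restriction i < j loses nothing: for j < i the quotient is the inverse of c(P), which F(P)
     also covers, and for i = j only a root of unity remains. *)
  have [lt_ij|lt_ji|/val_inj eq_ij] := ltngtP i j.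
  - right; exists (existT _ l (i, j)); first by split.
    by left; exists (u / v).
  - right; exists (existT _ l (j, i)); first by split=> //; rewrite setUC.
    by right; exists (u / v) => //=; rewrite invf_div.
  - by left; rewrite xy eq_ij divff // mulr1.
case=> [gammaU|[[l [i j]] [/= lt_ij ijE]]].
  have [gO g1 g0] := root_of_unity_OK sigma imagK gammaU; split=> //.
  (* Over the denominator 1 the ideal (gamma, 1) is O_K and both norms are 1, so the bound reduces
     to 1 <= B. *)
  rewrite -[gamma]divr1.
  apply/(height_fraction_le sigma imagK B gO (OK1 K) g0 (oner_neq0 K)).
  have -> : ideal_gen [set gamma; 1] = OK K.
    by apply: (ideal_with1 (integral_ideal_gen2 gO (OK1 K))); exact: mem_gen2r.
  by rewrite g1 (knorm1 sigma imagK) (ideal_norm_OK K) mulr1.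
have [_ gi0 _] := gen_bound l i; have [_ gj0 _] := gen_bound l j.
(* The two halves of F(P) differ by exchanging i and j, which leaves the ideal generated by the pair
   unchanged. *)
case=> -[z zU <-] /=; have [_ _ z0] := root_of_unity_OK sigma imagK zU; split.
- by rewrite !mulf_neq0 ?invr_neq0.
- by rewrite mulrA; apply: height_le.
- by rewrite !mulf_neq0 ?invr_neq0 // mulf_neq0 ?invr_neq0.
- by rewrite invf_div mulrA; apply: height_le => //; rewrite setUC.
Qed.
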